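(* For $|q|<1$, \begin{align*} &\sum_{k=0}^\infty \frac{q^{k^2}(-1;q)_{2k}(-1;q^2)_k}{(q^2;q^2)_{2k}}=\frac{1}{2}\left(3\frac{(q^2;q^2)_\infty^3}{(q;q)_\infty^2(q^4;q^4)_\infty}-\frac{(q;q)_\infty^2(q^2;q^2)_\infty}{(q^4;q^4)_\infty}\right),\\ &\sum_{k=0}^\infty \frac{q^{k^2+2k}(-1;q)_{2k}(-1;q^2)_k}{(q^2;q^2)_{2k}}=\frac{1}{2}\left(\frac{(q^2;q^2)_\infty^3}{(q;q)_\infty^2(q^4;q^4)_\infty}+\frac{(q;q)_\infty^2(q^2;q^2)_\infty}{(q^4;q^4)_\infty}\right),\\ &\sum_{k=0}^\infty \frac{q^{k^2+k}(-1;q)_{2k+1}(-q;q^2)_k}{(q^2;q^2)_{2k+1}}=\frac{1}{2}\left(3\frac{(q^4;q^4)_\infty}{(q;q)_\infty}+\frac{(q;q)_\infty^3(q^4;q^4)_\infty}{(q^2;q^2)_\infty^2}\right),\\ &\sum_{k=0}^\infty \frac{q^{k^2+3k+1}(-1;q)_{2k+1}(-q;q^2)_k}{(q^2;q^2)_{2k+1}}=\frac{1}{2}\left(\frac{(q^4;q^4)_\infty}{(q;q)_\infty}-\frac{(q;q)_\infty^3(q^4;q^4)_\infty}{(q^2;q^2)_\infty^2}\right). \end{align*}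
   Context: For a complex number $a$ and $|q|<1$, $(a;q)_n:=\prod_{k=0}^{n-1}(1-aq^k)$ for $n\in\mathbb{N}\cup\{\infty\}$. *)

(* Defs.v *)
From Stdlib Require Import Reals.
From Coquelicot Require Import Coquelicot.
Open Scope C_scope.

Fixpoint cpow (x : C) (n : nat) : C :=
  match n with O => 1 | S m => x * cpow x m end.

Fixpoint qpoch (a q : C) (n : nat) : C :=
  match n with
  | O => 1
  | S m => qpoch a q m * (1 - a * cpow q m)
  end.

Definition qpoch_inf (a q : C) : C :=
  @lim (CompleteNormedModule.CompleteSpace _ C_CompleteNormedModule)
    (filtermap (fun n => qpoch a q n) eventually).

(* Main.v *)
Require Import Defs.
From Stdlib Require Import Reals Lra Lia.
From Coquelicot Require Import Coquelicot.
Open Scope C_scope.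

(** Put Q = q^2, T_k = (-1)^k Q^(k(k-1)/2) w^k (a;Q)_k / ((aw;Q)_k (Q;Q)_k) and
    G(a,w) = sum_n w^n / (1 - a Q^n).  A telescoping contiguous relation in w gives
    sum_k T_k = (w;Q)_inf / (aw;Q)_inf, and one in a gives
    sum_k T_k Q^k / (1 - a Q^k) = G(a,w) (w;Q)_inf / (aw;Q)_inf.
    For (a,w) = (-1,-q) the second sum is half the second series of the theorem, and
    the first sum is half the sum of its first two series; (a,w) = (-q,-Q) plays the
    same role for the last two series, up to elementary factors.
    The symmetry G(a,w) = G(w,a) yields -q G(-q,-Q) = G(-1,-q) - 1/2, so only
    G(-1,-q) remains: 4 G(-1,-q) - 1 = ((q;q)_inf^2 / (q^2;q^2)_inf)^2 is Jacobi's
    two-square theorem, obtained as the limit of a finite identity with a WZ proof. *)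

(** The factor [1 / (1 - a Q^k)] comes from the series themselves. Since
    [(-1;q)_{2k} = 2 (-q;q)_{2k} / (1 + Q^k)], the even terms carry the denominator [1 + Q^k], and
    those of the first two series differ by the factor [q^{2k} = Q^k], so adding them cancels it. In
    the odd case the denominator is [1 + q^{2k+1}], and the exponents differ by exactly [2k+1]. The
    first sum is the classical 1phi1 summation with lower parameter [c = aw] and argument [c/a];
    using [w] as parameter avoids dividing by [a = -q], which may be 0. The value [a = -1] lies on
    the unit circle, so hypotheses on [a] mostly ask only that no [1 - a Q^n] vanishes, and the
    symmetry of G is used at [(-Q, -q)], one shift in [a] away from [(-1, -q)]. Infinite identities
    in [a] and [w] come from iterating a one-step relation N times and bounding the remainder
    geometrically, hence bounds uniform in the shifts. Finally [4 G(-1,-q) - 1 = 1 + 4 sum_{n>=1}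
    (-q)^n / (1 + q^{2n})], the Lambert series of the squared theta function
    [sum_n (-1)^n q^{n^2}]. *)

(** * Limits of complex sequences through real distances *)

Definition Clim (u : nat -> C) (l : C) : Prop :=
  is_lim_seq (fun n => Cmod (u n - l)) 0%R.

Lemma Clim_squeeze (u : nat -> C) (l : C) (e : nat -> R) :
  (forall n, (Cmod (u n - l) <= e n)%R) -> is_lim_seq e 0%R -> Clim u l.
Proof.
  intros H He. apply is_lim_seq_le_le with (fun _ => 0%R) e; trivial.
  - intros n; split; [apply Cmod_ge_0 | apply H].
  - apply is_lim_seq_const.
Qed.

Lemma Clim_ext (u v : nat -> C) (l : C) :
  (forall n, u n = v n) -> Clim u l -> Clim v l.
Proof.
  intros H. apply is_lim_seq_ext. intros n. now rewrite H.
Qed.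

Lemma Clim_const (c : C) : Clim (fun _ => c) c.
Proof.
  apply Clim_squeeze with (fun _ => 0%R); [|apply is_lim_seq_const].
  intros _. replace (c - c) with (RtoC 0) by ring. rewrite Cmod_0. lra.
Qed.

Lemma Clim_plus (u v : nat -> C) (l m : C) :
  Clim u l -> Clim v m -> Clim (fun n => u n + v n) (l + m).
Proof.
  intros Hu Hv.
  apply Clim_squeeze with (fun n => Cmod (u n - l) + Cmod (v n - m))%R.
  - intros n. replace (u n + v n - (l + m)) with ((u n - l) + (v n - m)) by ring.
    apply Cmod_triangle.
  - replace 0%R with (0 + 0)%R by lra. now apply is_lim_seq_plus'.
Qed.

Lemma Clim_mult (u v : nat -> C) (l m : C) :
  Clim u l -> Clim v m -> Clim (fun n => u n * v n) (l * m).
Proof.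
  intros Hu Hv.
  apply Clim_squeeze with (fun n => Cmod (u n - l) * (Cmod (v n - m) + Cmod m)
                                    + Cmod l * Cmod (v n - m))%R.
  - intros n.
    replace (u n * v n - l * m)
      with ((u n - l) * ((v n - m) + m) + l * (v n - m)) by ring.
    eapply Rle_trans; [apply Cmod_triangle|]. rewrite !Cmod_mult.
    apply Rplus_le_compat_r, Rmult_le_compat_l;
      [apply Cmod_ge_0 | apply Cmod_triangle].
  - replace 0%R with (0 * (0 + Cmod m) + Cmod l * 0)%R by ring.
    apply is_lim_seq_plus'; apply is_lim_seq_mult'; trivial.
    + apply is_lim_seq_plus'; trivial. apply is_lim_seq_const.
    + apply is_lim_seq_const.
Qed.

Lemma Clim_scal (c : C) (u : nat -> C) (l : C) :
  Clim u l -> Clim (fun n => c * u n) (c * l).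
Proof. intros H. apply Clim_mult; trivial. apply Clim_const. Qed.

Lemma Clim_minus (u v : nat -> C) (l m : C) :
  Clim u l -> Clim v m -> Clim (fun n => u n - v n) (l - m).
Proof.
  intros Hu Hv. replace (l - m) with (l + (-(1)) * m) by ring.
  apply Clim_ext with (fun n => u n + (-(1)) * v n); [intros; ring|].
  apply Clim_plus; trivial. now apply Clim_scal.
Qed.

Lemma Clim_unique (u : nat -> C) (l m : C) : Clim u l -> Clim u m -> l = m.
Proof.
  intros Hl Hm. pose proof (Clim_minus _ _ _ _ Hl Hm) as H.
  assert (H0 : Clim (fun n => u n - u n) 0).
  { apply Clim_ext with (fun _ => RtoC 0); [intros; ring | apply Clim_const]. }
  assert (Hlim : is_lim_seq (fun _ => Cmod (l - m)) 0%R).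
  { replace 0%R with (0 + 0)%R by lra.
    apply is_lim_seq_le_le with (fun _ => 0%R)
      (fun n => (Cmod (u n - l) + Cmod (u n - m))%R).
    - intros n; split; [apply Cmod_ge_0|].
      replace (l - m) with (- (u n - l) + (u n - m)) by ring.
      eapply Rle_trans; [apply Cmod_triangle|]. rewrite Cmod_opp. lra.
    - replace (0 + 0)%R with 0%R by lra. apply is_lim_seq_const.
    - now apply is_lim_seq_plus'. }
  apply is_lim_seq_unique in Hlim. rewrite Lim_seq_const in Hlim.
  injection Hlim as Hlim. apply Cmod_eq_0 in Hlim.
  replace l with ((l - m) + m) by ring. rewrite Hlim. ring.
Qed.

Lemma Clim_incr_n (u : nat -> C) (l : C) (N : nat) :
  Clim u l -> Clim (fun n => u (n + N)%nat) l.
Proof.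
  intros H. apply (is_lim_seq_incr_n (fun n => Cmod (u n - l)) N). exact H.
Qed.

Lemma Clim_inv (u : nat -> C) (l : C) (c : R) :
  (0 < c)%R -> (forall n, (c <= Cmod (u n))%R) -> l <> 0 ->
  Clim u l -> Clim (fun n => / u n) (/ l).
Proof.
  intros Hc Hu Hl H.
  assert (Hl' := proj1 (Cmod_gt_0 l) Hl).
  apply Clim_squeeze with (fun n => (/ (c * Cmod l)) * Cmod (u n - l))%R.
  - intros n. assert (Hn : u n <> 0).
    { apply Cmod_gt_0. specialize (Hu n). lra. }
    replace (/ u n - / l) with (- ((/ (u n * l)) * (u n - l))) by (field; auto).
    rewrite Cmod_opp, Cmod_mult, Cmod_inv, Cmod_mult.
    2: now apply Cmult_neq_0.
    apply Rmult_le_compat_r; [apply Cmod_ge_0|].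
    apply Rinv_le_contravar; [now apply Rmult_lt_0_compat|].
    apply Rmult_le_compat_r; [lra | apply Hu].
  - replace 0%R with (/ (c * Cmod l) * 0)%R by ring.
    apply is_lim_seq_mult'; trivial. apply is_lim_seq_const.
Qed.

Lemma Clim_Cmod_le (u : nat -> C) (l : C) (B : R) :
  (forall n, (Cmod (u n) <= B)%R) -> Clim u l -> (Cmod l <= B)%R.
Proof.
  intros Hu H.
  apply (is_lim_seq_le (fun _ => Cmod l) (fun n => (Cmod (u n - l) + B)%R) (Cmod l) B).
  - intros n. replace l with (- (u n - l) + u n) at 1 by ring.
    eapply Rle_trans; [apply Cmod_triangle|]. rewrite Cmod_opp.
    specialize (Hu n). lra.
  - apply is_lim_seq_const.
  - replace (Finite B) with (Finite (0 + B)) by (f_equal; lra).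
    apply is_lim_seq_plus'; [exact H | apply is_lim_seq_const].
Qed.

Lemma Clim_Cmod_ge (u : nat -> C) (l : C) (B : R) :
  (forall n, (B <= Cmod (u n))%R) -> Clim u l -> (B <= Cmod l)%R.
Proof.
  intros Hu H.
  apply (is_lim_seq_le (fun _ => B) (fun n => (Cmod (u n - l) + Cmod l)%R) B (Cmod l)).
  - intros n. eapply Rle_trans; [apply Hu|].
    replace (u n) with ((u n - l) + l) at 1 by ring. apply Cmod_triangle.
  - apply is_lim_seq_const.
  - replace (Finite (Cmod l)) with (Finite (0 + Cmod l)) by (f_equal; lra).
    apply is_lim_seq_plus'; [exact H | apply is_lim_seq_const].
Qed.

Lemma Clim_filterlim (u : nat -> C) (l : C) :
  Clim u l -> filterlim u eventually (locally (T := C_NormedModule) l).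
Proof.
  intros H P [eps HP].
  destruct (H (fun y => (y < eps)%R)) as [N HN].
  { exists eps. intros y Hy. unfold ball in Hy; simpl in Hy.
    unfold AbsRing_ball, abs, minus, plus, opp in Hy; simpl in Hy.
    apply Rabs_def2 in Hy. lra. }
  exists N. intros n Hn. apply HP, C_NormedModule_mixin_compat1. now apply HN.
Qed.

(** [lim] is a total operator, meaningful only on Cauchy filters. Convergence makes the filter
    Cauchy, completeness makes it converge to its [lim], and uniqueness of limits identifies that
    with [l]. This gives access to [qpoch_inf]. *)
Lemma Clim_lim (u : nat -> C) (l : C) : Clim u l ->
  @lim (CompleteNormedModule.CompleteSpace _ C_CompleteNormedModule)
    (filtermap u eventually) = l.
Proof.
  intros H.
  pose proof (Clim_filterlim _ _ H) as HF.
  set (T := CompleteNormedModule.CompleteSpace _ C_CompleteNormedModule).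
  set (F := filtermap u eventually).
  assert (PF : @ProperFilter T F) by (apply filtermap_proper_filter, eventually_filter).
  assert (HC : @cauchy T F).
  { intros eps. exists l. apply HF. exists eps. auto. }
  pose proof (@complete_cauchy T F PF HC) as Hlim.
  apply (@filterlim_locally_unique nat C_AbsRing C_NormedModule eventually _ u);
    trivial.
  intros P [eps HP]. generalize (Hlim eps). apply filter_imp.
  intros x Hx. now apply HP.
Qed.

(** * Complex series, geometric domination and Tannery's theorem *)

(** The upper bound is excluded, unlike in [sum_n], so that the empty sum exists and telescoping
    sums equal [U n - U O]. *)
Fixpoint csum (f : nat -> C) (n : nat) : C :=
  match n with O => 0 | S m => csum f m + f m end.

Definition Cseries (f : nat -> C) (l : C) : Prop := Clim (csum f) l.

Lemma csum_ext (f g : nat -> C) (n : nat) :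
  (forall k, (k < n)%nat -> f k = g k) -> csum f n = csum g n.
Proof.
  induction n as [|n IH]; simpl; intros H; trivial.
  rewrite IH, H; trivial; [lia|]. intros k Hk. apply H. lia.
Qed.

Lemma csum_plus (f g : nat -> C) (n : nat) :
  csum (fun k => f k + g k) n = csum f n + csum g n.
Proof. induction n as [|n IH]; simpl; [ring | rewrite IH; ring]. Qed.

Lemma csum_scal (c : C) (f : nat -> C) (n : nat) :
  csum (fun k => c * f k) n = c * csum f n.
Proof. induction n as [|n IH]; simpl; [ring | rewrite IH; ring]. Qed.

Lemma csum_shift (f : nat -> C) (n : nat) :
  csum f (S n) = f O + csum (fun k => f (S k)) n.
Proof.
  induction n as [|n IH]; [simpl; ring|].
  change (csum f (S (S n))) with (csum f (S n) + f (S n)).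
  rewrite IH. simpl. ring.
Qed.

Lemma csum_telescope (U : nat -> C) (n : nat) :
  csum (fun k => U (S k) - U k) n = U n - U O.
Proof. induction n as [|n IH]; simpl; [ring | rewrite IH; ring]. Qed.

Lemma Cseries_is_series (f : nat -> C) (l : C) :
  Cseries f l -> is_series (V := C_NormedModule) f l.
Proof.
  intros H. apply Clim_filterlim.
  apply Clim_ext with (fun n => csum f (n + 1)%nat); [|now apply Clim_incr_n].
  intros n. rewrite Nat.add_1_r.
  induction n as [|n IH].
  - rewrite sum_O. simpl. ring.
  - rewrite sum_Sn, <- IH. reflexivity.
Qed.

Lemma Cseries_ext (f g : nat -> C) (l : C) :
  (forall n, f n = g n) -> Cseries f l -> Cseries g l.
Proof.
  intros H. apply Clim_ext. intros n. apply csum_ext. auto.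
Qed.

Lemma Cseries_plus (f g : nat -> C) (l m : C) :
  Cseries f l -> Cseries g m -> Cseries (fun k => f k + g k) (l + m).
Proof.
  intros Hf Hg. apply Clim_ext with (fun n => csum f n + csum g n).
  - intros n. now rewrite csum_plus.
  - now apply Clim_plus.
Qed.

Lemma Cseries_scal (c : C) (f : nat -> C) (l : C) :
  Cseries f l -> Cseries (fun k => c * f k) (c * l).
Proof.
  intros Hf. apply Clim_ext with (fun n => c * csum f n).
  - intros n. now rewrite csum_scal.
  - now apply Clim_scal.
Qed.

Lemma Cseries_minus (f g : nat -> C) (l m : C) :
  Cseries f l -> Cseries g m -> Cseries (fun k => f k - g k) (l - m).
Proof.
  intros Hf Hg. replace (l - m) with (l + (-(1)) * m) by ring.
  apply Cseries_ext with (fun k => f k + (-(1)) * g k); [intros; ring|].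
  apply Cseries_plus; trivial. now apply Cseries_scal.
Qed.

Lemma Cseries_unique (f : nat -> C) (l m : C) :
  Cseries f l -> Cseries f m -> l = m.
Proof. apply Clim_unique. Qed.

Lemma Cseries_decr_1 (f : nat -> C) (l : C) :
  Cseries f l -> Cseries (fun k => f (S k)) (l - f O).
Proof.
  intros H. apply Clim_ext with (fun n => csum f (n + 1)%nat - f O).
  - intros n. rewrite Nat.add_1_r, csum_shift. ring.
  - apply Clim_minus; [now apply Clim_incr_n | apply Clim_const].
Qed.

Lemma Cseries_telescope (U : nat -> C) (l : C) :
  Clim U l -> Cseries (fun k => U (S k) - U k) (l - U O).
Proof.
  intros H. apply Clim_ext with (fun n => U n - U O).
  - intros n. now rewrite csum_telescope.
  - apply Clim_minus; trivial. apply Clim_const.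
Qed.

Lemma geom_partial_le (r : R) (n : nat) :
  (0 <= r < 1)%R -> ((1 - r ^ n) / (1 - r) <= / (1 - r))%R.
Proof.
  intros Hr. pose proof (pow_le r n (proj1 Hr)).
  assert (0 < / (1 - r))%R by (apply Rinv_0_lt_compat; lra).
  unfold Rdiv. nra.
Qed.

Lemma csum_geom_le (f : nat -> C) (B r : R) (n : nat) :
  (0 <= r < 1)%R -> (forall k, (k < n)%nat -> (Cmod (f k) <= B * r ^ k)%R) ->
  (Cmod (csum f n) <= B * ((1 - r ^ n) / (1 - r)))%R.
Proof.
  intros Hr. induction n as [|n IH]; intros H.
  - simpl. rewrite Cmod_0. right. field. lra.
  - simpl csum. eapply Rle_trans; [apply Cmod_triangle|].
    eapply Rle_trans; [apply Rplus_le_compat;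
      [apply IH; intros; apply H; lia | apply (H n); lia]|].
    right. simpl. field. lra.
Qed.

Lemma Cseries_geom_ex (f : nat -> C) (B r : R) :
  (0 <= r < 1)%R -> (forall k, (Cmod (f k) <= B * r ^ k)%R) ->
  exists l, Cseries f l.
Proof.
  intros Hr H.
  assert (Hex : ex_series (V := C_CompleteNormedModule) f).
  { apply ex_series_le with (fun k => B * r ^ k)%R.
    - exact H.
    - apply (ex_series_scal B (fun k => r ^ k)%R), ex_series_geom.
      rewrite Rabs_pos_eq; lra. }
  destruct Hex as [l Hl]. exists l.
  apply (is_lim_seq_incr_1 (fun n => Cmod (csum f n - l))).
  apply is_lim_seq_spec. intros eps.
  (* Balls of [C] are products of real balls, so membership bounds [Cmod] only by [sqrt 2] times the
     radius; halving [eps] absorbs that factor. *)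
  assert (He : (0 < eps / 2)%R) by (apply Rdiv_lt_0_compat; [apply eps | lra]).
  destruct (Hl (fun y => Cmod (y - l) < eps)%R) as [N HN].
  { exists (mkposreal _ He). intros y Hy.
    pose proof (C_NormedModule_mixin_compat2 l y _ Hy) as Hy'. simpl in Hy'.
    eapply Rlt_le_trans; [exact Hy'|].
    assert (sqrt 2 <= 2)%R.
    { rewrite <- (sqrt_square 2) at 2 by lra. apply sqrt_le_1; lra. }
    pose proof (cond_pos eps). nra. }
  exists N. intros n Hn. specialize (HN n Hn).
  assert (Hs : csum f (S n) = sum_n (G := C_NormedModule) f n).
  { clear. induction n as [|n IH].
    - rewrite sum_O. simpl. ring.
    - rewrite sum_Sn, <- IH. reflexivity. }
  rewrite Hs, Rminus_0_r, Rabs_pos_eq by apply Cmod_ge_0. exact HN.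
Qed.

Lemma Cseries_geom_le (f : nat -> C) (B r : R) (l : C) :
  (0 <= r < 1)%R -> (0 <= B)%R -> (forall k, (Cmod (f k) <= B * r ^ k)%R) ->
  Cseries f l -> (Cmod l <= B / (1 - r))%R.
Proof.
  intros Hr HB H. apply Clim_Cmod_le. intros n.
  eapply Rle_trans; [apply csum_geom_le; eauto|].
  apply Rmult_le_compat_l; trivial. now apply geom_partial_le.
Qed.

(** Tannery's theorem for triangular arrays: domination is required only for [k <= N], where the
    terms of the finite identity are meaningful. *)
Lemma csum_tannery (f : nat -> nat -> C) (g : nat -> C) (B r : R) (l : C) :
  (0 <= r < 1)%R -> (0 <= B)%R ->
  (forall N k, (k <= N)%nat -> (Cmod (f N k) <= B * r ^ k)%R) ->
  (forall k, Clim (fun N => f N k) (g k)) ->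
  Cseries g l -> Clim (fun N => csum (f N) (S N)) l.
Proof.
  intros Hr HB Hf Hg Hl.
  (* The limit terms inherit the bound; shifting [N] by [k] keeps the index inside the triangle. *)
  assert (Hgb : forall k, (Cmod (g k) <= B * r ^ k)%R).
  { intros k. apply (Clim_Cmod_le (fun N => f (N + k)%nat k)).
    - intros N. apply Hf. lia.
    - apply (Clim_incr_n (fun N => f N k)), Hg. }
  apply is_lim_seq_spec. intros eps.
  (* With the factor 4, each of the two tails beyond [K] is below [eps / 8], which leaves [eps / 2]
     for the head. *)
  assert (Hgeo : is_lim_seq (fun n => (4 * (B / (1 - r)) * r ^ n)%R) 0%R).
  { replace 0%R with (4 * (B / (1 - r)) * 0)%R by ring.
    apply is_lim_seq_mult'; [apply is_lim_seq_const|].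
    apply is_lim_seq_geom. rewrite Rabs_pos_eq; lra. }
  apply is_lim_seq_spec in Hgeo. destruct (Hgeo (mkposreal _ (is_pos_div_2 eps))) as [K HK].
  specialize (HK K (le_n K)). simpl in HK. rewrite Rminus_0_r in HK.
  apply Rabs_def2 in HK. destruct HK as [HK _].
  assert (Hhead : Clim (fun N => csum (f N) K) (csum g K)).
  { clear - Hg. induction K as [|K IH]; simpl.
    - apply Clim_const.
    - now apply Clim_plus. }
  apply is_lim_seq_spec in Hhead.
  destruct (Hhead (mkposreal _ (is_pos_div_2 eps))) as [N0 HN0]. simpl in HN0.
  assert (Htail : forall (h : nat -> C) M n,
     (forall k, (k < K + n)%nat -> (Cmod (h k) <= M * r ^ k)%R) -> (0 <= M)%R ->
     (Cmod (csum h (K + n) - csum h K) <= M / (1 - r) * r ^ K)%R).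
  { intros h M n Hh HM.
    assert (E : csum h (K + n) - csum h K = csum (fun k => h (K + k)%nat) n).
    { clear. induction n as [|n IH].
      - rewrite Nat.add_0_r. simpl. ring.
      - rewrite Nat.add_succ_r. simpl. rewrite <- IH. ring. }
    rewrite E.
    eapply Rle_trans; [apply csum_geom_le with (B := (M * r ^ K)%R) (r := r); trivial|].
    - intros k Hk. rewrite Rmult_assoc, <- pow_add. apply Hh. lia.
    - pose proof (geom_partial_le r n Hr).
      replace (M / (1 - r) * r ^ K)%R with (M * r ^ K * / (1 - r))%R by (field; lra).
      apply Rmult_le_compat_l; trivial.
      apply Rmult_le_pos; trivial. apply pow_le. lra. }
  assert (Hgt : (Cmod (l - csum g K) <= B / (1 - r) * r ^ K)%R).
  { apply (Clim_Cmod_le (fun n => csum g (n + K)%nat - csum g K)).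
    - intros n. rewrite Nat.add_comm. apply Htail; auto.
    - apply Clim_minus; [now apply Clim_incr_n | apply Clim_const]. }
  exists (N0 + K)%nat. intros N HN.
  specialize (HN0 N ltac:(lia)).
  rewrite Rminus_0_r, Rabs_pos_eq in HN0 |- * by apply Cmod_ge_0.
  assert (Hft := Htail (f N) B (S N - K)%nat).
  replace (K + (S N - K))%nat with (S N) in Hft by lia.
  specialize (Hft ltac:(intros; apply Hf; lia) HB).
  replace (csum (f N) (S N) - l)
    with ((csum (f N) (S N) - csum (f N) K) + (csum (f N) K - csum g K)
          + - (l - csum g K)) by ring.
  eapply Rle_lt_trans; [apply Cmod_triangle|]. rewrite Cmod_opp.
  eapply Rle_lt_trans; [apply Rplus_le_compat_r, Cmod_triangle|].
  pose proof (cond_pos eps). lra.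
Qed.

(** * Powers, uniform bounds on q-Pochhammer symbols, infinite products *)

Lemma cpow_add (x : C) (m n : nat) : cpow x (m + n) = cpow x m * cpow x n.
Proof. induction m as [|m IH]; simpl; [ring | rewrite IH; ring]. Qed.

Lemma cpow_mult_base (x y : C) (n : nat) : cpow (x * y) n = cpow x n * cpow y n.
Proof. induction n as [|n IH]; simpl; [ring | rewrite IH; ring]. Qed.

Lemma Cmod_cpow (x : C) (n : nat) : Cmod (cpow x n) = (Cmod x ^ n)%R.
Proof.
  induction n as [|n IH]; simpl; [apply Cmod_1 | now rewrite Cmod_mult, IH].
Qed.

Lemma Clim_cpow (p : C) : (Cmod p < 1)%R -> Clim (cpow p) 0.
Proof.
  intros Hp. apply Clim_squeeze with (fun n => (Cmod p ^ n)%R).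
  - intros n. rewrite <- Cmod_cpow. right. f_equal. ring.
  - apply is_lim_seq_geom. rewrite Rabs_pos_eq; trivial. apply Cmod_ge_0.
Qed.

Lemma pow_le_1 (r : R) (n : nat) : (0 <= r <= 1)%R -> (r ^ n <= 1)%R.
Proof. intros H. rewrite <- (pow1 n). now apply pow_incr. Qed.

Lemma Cmod_cpow_le_1 (p : C) (n : nat) : (Cmod p < 1)%R -> (Cmod (cpow p n) <= 1)%R.
Proof.
  intros Hp. rewrite Cmod_cpow. apply pow_le_1. pose proof (Cmod_ge_0 p). lra.
Qed.

Lemma Cmod_mult_cpow_le (a p : C) (n : nat) :
  (Cmod p < 1)%R -> (Cmod (a * cpow p n) <= Cmod a)%R.
Proof.
  intros Hp. rewrite Cmod_mult. pose proof (Cmod_cpow_le_1 p n Hp).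
  pose proof (Cmod_ge_0 a). nra.
Qed.

Lemma Cmod_one_minus_ge (x : C) : (1 - Cmod x <= Cmod (1 - x))%R.
Proof.
  pose proof (Cmod_triangle (1 - x) x) as H.
  replace (1 - x + x) with (RtoC 1) in H by ring. rewrite Cmod_1 in H. lra.
Qed.

Lemma one_minus_neq_0 (x : C) : (Cmod x < 1)%R -> 1 - x <> 0.
Proof.
  intros Hx. apply Cmod_gt_0. pose proof (Cmod_one_minus_ge x). lra.
Qed.

Lemma one_plus_neq_0 (x : C) : (Cmod x < 1)%R -> 1 + x <> 0.
Proof.
  intros Hx. replace (1 + x) with (1 - - x) by ring.
  apply one_minus_neq_0. now rewrite Cmod_opp.
Qed.

(** No factor of [(a;p)_inf] vanishes. This replaces [Cmod a < 1], which fails for [a = -1]. *)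
Definition qpoch_regular (a p : C) : Prop := forall n, 1 - a * cpow p n <> 0.

Lemma qpoch_regular_small (a p : C) :
  (Cmod p < 1)%R -> (Cmod a < 1)%R -> qpoch_regular a p.
Proof.
  intros Hp Ha n. apply one_minus_neq_0. pose proof (Cmod_mult_cpow_le a p n Hp). lra.
Qed.

Lemma qpoch_regular_shift (a p : C) (N : nat) :
  qpoch_regular a p -> qpoch_regular (a * cpow p N) p.
Proof.
  intros H n. rewrite <- Cmult_assoc, <- cpow_add. apply H.
Qed.

Lemma qpoch_neq_0 (a p : C) (n : nat) : qpoch_regular a p -> qpoch a p n <> 0.
Proof.
  intros H. induction n as [|n IH]; simpl.
  - apply C1_nz.
  - apply Cmult_neq_0; auto.
Qed.

Lemma qpoch_add (a p : C) (m n : nat) :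
  qpoch a p (m + n) = qpoch a p m * qpoch (a * cpow p m) p n.
Proof.
  induction n as [|n IH]; simpl.
  - rewrite Nat.add_0_r. ring.
  - rewrite Nat.add_succ_r. simpl. rewrite IH, cpow_add. ring.
Qed.

Lemma qpoch_head (a p : C) (n : nat) :
  qpoch a p (S n) = (1 - a) * qpoch (a * p) p n.
Proof.
  change (S n) with (1 + n)%nat. rewrite qpoch_add. simpl.
  rewrite !Cmult_1_r, Cmult_1_l. reflexivity.
Qed.

(** Each factor is at most [1 + x <= exp x] with [x = |a| |p|^k], and the exponents sum to a
    geometric series. The bound holds for all shifts [a p^N] at once. *)
Lemma qpoch_Cmod_le (a p : C) (N n : nat) : (Cmod p < 1)%R ->
  (Cmod (qpoch (a * cpow p N) p n) <= exp (Cmod a / (1 - Cmod p)))%R.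
Proof.
  intros Hp. pose proof (Cmod_ge_0 p). pose proof (Cmod_ge_0 a).
  pose proof (Cmod_mult_cpow_le a p N Hp) as Hb.
  set (b := a * cpow p N) in *.
  apply Rle_trans with (exp (Cmod a * ((1 - Cmod p ^ n) / (1 - Cmod p))))%R.
  - induction n as [|n IH].
    + simpl. rewrite Cmod_1. unfold Rminus at 1.
      replace (Cmod a * ((1 + - (1)) / (1 - Cmod p)))%R with 0%R by (field; lra).
      rewrite exp_0. lra.
    + simpl qpoch. rewrite Cmod_mult.
      replace (Cmod a * ((1 - Cmod p ^ S n) / (1 - Cmod p)))%R
        with (Cmod a * ((1 - Cmod p ^ n) / (1 - Cmod p)) + Cmod a * Cmod p ^ n)%R
        by (simpl; field; lra).
      rewrite exp_plus. apply Rmult_le_compat; try apply Cmod_ge_0; trivial.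
      eapply Rle_trans; [apply (Cmod_triangle 1 (- (b * cpow p n)))|].
      rewrite Cmod_1, Cmod_opp, Cmod_mult, Cmod_cpow.
      eapply Rle_trans; [|apply exp_ineq1_le].
      apply Rplus_le_compat_l, Rmult_le_compat_r; trivial. now apply pow_le.
  - assert (H1 : (Cmod a * ((1 - Cmod p ^ n) / (1 - Cmod p)) <= Cmod a / (1 - Cmod p))%R).
    { apply Rmult_le_compat_l; trivial. apply geom_partial_le. lra. }
    destruct H1 as [H1|H1]; [left; now apply exp_increasing | right; now rewrite H1].
Qed.

(** Weierstrass product inequality: a product of factors [1 - x_k] is at least [1 - sum x_k], here
    with a sum of at most 1/2. *)
Lemma qpoch_Cmod_ge_small (a p : C) (n : nat) : (Cmod p < 1)%R ->
  (Cmod a / (1 - Cmod p) <= 1 / 2)%R -> (1 / 2 <= Cmod (qpoch a p n))%R.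
Proof.
  intros Hp Ha. pose proof (Cmod_ge_0 p). pose proof (Cmod_ge_0 a).
  assert (Hpart : forall m, (Cmod a * ((1 - Cmod p ^ m) / (1 - Cmod p)) <= 1 / 2)%R).
  { intros m. eapply Rle_trans; [|exact Ha].
    apply Rmult_le_compat_l; trivial. apply geom_partial_le. lra. }
  assert (H1 : (1 - Cmod a * ((1 - Cmod p ^ n) / (1 - Cmod p)) <= Cmod (qpoch a p n))%R).
  { induction n as [|n IH].
    - simpl. rewrite Cmod_1. right. field. lra.
    - simpl qpoch. rewrite Cmod_mult.
      pose proof (Cmod_one_minus_ge (a * cpow p n)) as Hf.
      rewrite Cmod_mult, Cmod_cpow in Hf.
      pose proof (pow_le (Cmod p) n H).
      assert (Hs : (Cmod a * ((1 - Cmod p ^ S n) / (1 - Cmod p))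
        = Cmod a * ((1 - Cmod p ^ n) / (1 - Cmod p)) + Cmod a * Cmod p ^ n)%R)
        by (simpl; field; lra).
      pose proof (Hpart n) as Hn. pose proof (Hpart (S n)) as HSn. rewrite Hs in *.
      set (s := (Cmod a * ((1 - Cmod p ^ n) / (1 - Cmod p)))%R) in *.
      set (t := (Cmod a * Cmod p ^ n)%R) in *.
      assert (0 <= t)%R by (apply Rmult_le_pos; trivial).
      assert (0 <= s)%R.
      { apply Rmult_le_pos; trivial. apply Rdiv_le_0_compat; [|lra].
        pose proof (pow_le_1 (Cmod p) n). lra. }
      apply Rle_trans with ((1 - s) * (1 - t))%R; [nra|].
      apply Rmult_le_compat; lra. }
  specialize (Hpart n). lra.
Qed.

(** For [N = 0], the product is cut at a [K] beyond which the previous lemma applies; finitely many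
    nonzero values remain. A general shift is the quotient [(a;p)_{N+n} / (a;p)_N], whose
    denominator is bounded above; hence the witness [c / M]. *)
Lemma qpoch_Cmod_ge (a p : C) : (Cmod p < 1)%R -> qpoch_regular a p ->
  exists c, (0 < c)%R /\ forall N n, (c <= Cmod (qpoch (a * cpow p N) p n))%R.
Proof.
  intros Hp Ha.
  assert (H0 : exists c, (0 < c)%R /\ forall n, (c <= Cmod (qpoch a p n))%R).
  { assert (HL : is_lim_seq (fun n => Cmod a / (1 - Cmod p) * Cmod p ^ n)%R 0%R).
    { replace 0%R with (Cmod a / (1 - Cmod p) * 0)%R by ring.
      apply is_lim_seq_mult'; [apply is_lim_seq_const | apply is_lim_seq_geom].
      rewrite Rabs_pos_eq; trivial. apply Cmod_ge_0. }
    apply is_lim_seq_spec in HL.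
    destruct (HL (mkposreal (1 / 2) ltac:(lra))) as [K HK]. specialize (HK K (le_n K)).
    simpl in HK. rewrite Rminus_0_r in HK. apply Rabs_def2 in HK. destruct HK as [HK _].
    assert (Htail : forall n, (1 / 2 <= Cmod (qpoch (a * cpow p K) p n))%R).
    { intros n. apply qpoch_Cmod_ge_small; trivial.
      rewrite Cmod_mult, Cmod_cpow. unfold Rdiv in *. nra. }
    assert (Hhead : exists c, (0 < c)%R /\
                      forall n, (n <= K)%nat -> (c <= Cmod (qpoch a p n))%R).
    { clear - Ha. induction K as [|K [c [Hc IH]]].
      - exists 1%R. split; [lra|]. intros n Hn. replace n with O by lia.
        simpl. rewrite Cmod_1. lra.
      - exists (Rmin c (Cmod (qpoch a p (S K)))). split.
        + apply Rmin_glb_lt; trivial. now apply Cmod_gt_0, qpoch_neq_0.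
        + intros n Hn. destruct (Nat.eq_dec n (S K)) as [->|].
          * apply Rmin_r.
          * eapply Rle_trans; [apply Rmin_l|]. apply IH. lia. }
    destruct Hhead as [c [Hc Hhead]]. exists (c / 2)%R. split; [lra|]. intros n.
    destruct (Nat.le_gt_cases n K) as [Hn|Hn].
    - specialize (Hhead n Hn). lra.
    - replace n with (K + (n - K))%nat by lia. rewrite qpoch_add, Cmod_mult.
      specialize (Hhead K (le_n K)). specialize (Htail (n - K)%nat). nra. }
  destruct H0 as [c [Hc H0]].
  set (M := exp (Cmod a / (1 - Cmod p))).
  assert (HM : (0 < M)%R) by apply exp_pos.
  exists (c / M)%R. split; [now apply Rdiv_lt_0_compat|]. intros N n.
  specialize (H0 (N + n)%nat). rewrite qpoch_add, Cmod_mult in H0.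
  pose proof (qpoch_Cmod_le a p 0 N Hp) as Hu. simpl in Hu. rewrite Cmult_1_r in Hu.
  fold M in Hu. apply Rle_div_l; trivial.
  pose proof (Cmod_ge_0 (qpoch (a * cpow p N) p n)). nra.
Qed.

(** The partial products are 1 plus the partial sums of their increments [-a p^n (a;p)_n], which are
    geometrically dominated. *)
Lemma qpoch_lim (a p : C) : (Cmod p < 1)%R -> Clim (qpoch a p) (qpoch_inf a p).
Proof.
  intros Hp.
  assert (Hex : exists l, Clim (qpoch a p) l).
  { destruct (Cseries_geom_ex (fun n => - (a * cpow p n) * qpoch a p n)
      (Cmod a * exp (Cmod a / (1 - Cmod p)))%R (Cmod p)) as [l Hl].
    - split; trivial. apply Cmod_ge_0.
    - intros n. rewrite Cmod_mult, Cmod_opp, Cmod_mult, Cmod_cpow.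
      pose proof (qpoch_Cmod_le a p 0 n Hp) as Hu. simpl in Hu. rewrite Cmult_1_r in Hu.
      pose proof (Cmod_ge_0 a). pose proof (pow_le (Cmod p) n (Cmod_ge_0 p)).
      set (E := exp (Cmod a / (1 - Cmod p))) in *.
      replace (Cmod a * E * Cmod p ^ n)%R with (Cmod a * Cmod p ^ n * E)%R by ring.
      apply Rmult_le_compat_l; trivial. now apply Rmult_le_pos.
    - exists (1 + l). apply Clim_ext with (fun n => 1 + csum (fun n => - (a * cpow p n) * qpoch a p n) n).
      + intros n. induction n as [|n IH]; simpl; [ring|].
        rewrite Cplus_assoc, IH. ring.
      + apply Clim_plus; trivial. apply Clim_const. }
  destruct Hex as [l Hl]. unfold qpoch_inf.
  rewrite (Clim_lim (fun n => qpoch a p n) l); exact Hl.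
Qed.

Lemma qpoch_inf_neq_0 (a p : C) :
  (Cmod p < 1)%R -> qpoch_regular a p -> qpoch_inf a p <> 0.
Proof.
  intros Hp Ha. destruct (qpoch_Cmod_ge a p Hp Ha) as [c [Hc H]].
  apply Cmod_gt_0. apply Rlt_le_trans with c; trivial.
  apply Clim_Cmod_ge with (qpoch a p); [|now apply qpoch_lim].
  intros n. specialize (H O n). simpl in H. now rewrite Cmult_1_r in H.
Qed.

Lemma qpoch_inf_head (a p : C) :
  (Cmod p < 1)%R -> qpoch_inf a p = (1 - a) * qpoch_inf (a * p) p.
Proof.
  intros Hp. apply Clim_unique with (fun n => qpoch a p (n + 1)%nat).
  - now apply Clim_incr_n, qpoch_lim.
  - apply Clim_ext with (fun n => (1 - a) * qpoch (a * p) p n).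
    + intros n. now rewrite Nat.add_1_r, qpoch_head.
    + now apply Clim_scal, qpoch_lim.
Qed.

(** * The 1phi1 summation *)

(** Closed form [(-w)^n p^(n(n-1)/2)]; the recursion avoids the halved exponent. *)
Fixpoint gauss (w p : C) (n : nat) : C :=
  match n with O => 1 | S m => gauss w p m * - (w * cpow p m) end.

Lemma gauss_shift (w p : C) (n : nat) : gauss (w * p) p n = gauss w p n * cpow p n.
Proof. induction n as [|n IH]; simpl; [ring | rewrite IH; ring]. Qed.

Lemma Cmod_gauss_le (w p : C) (n : nat) :
  (Cmod p < 1)%R -> (Cmod (gauss w p n) <= Cmod w ^ n)%R.
Proof.
  intros Hp. induction n as [|n IH]; simpl.
  - rewrite Cmod_1. lra.
  - rewrite Cmod_mult, Cmod_opp, (Rmult_comm (Cmod w)).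
    apply Rmult_le_compat; try apply Cmod_ge_0; trivial. now apply Cmod_mult_cpow_le.
Qed.

(* Term of the 1phi1 series with argument w and parameters a; aw. *)
Definition hterm (a w p : C) (k : nat) : C :=
  gauss w p k * qpoch a p k / (qpoch (a * w) p k * qpoch p p k).

Lemma Cmod_div_le (x y : C) (X c : R) :
  (0 < c)%R -> (Cmod x <= X)%R -> (c <= Cmod y)%R -> (Cmod (x / y) <= X / c)%R.
Proof.
  intros Hc Hx Hy.
  assert (Hy0 : y <> 0) by (apply Cmod_gt_0; lra).
  rewrite Cmod_div by trivial. apply Rmult_le_compat; trivial.
  - apply Cmod_ge_0.
  - left. apply Rinv_0_lt_compat. lra.
  - now apply Rinv_le_contravar.
Qed.

(** One constant serves all shifts of both parameters: shifts of [w] are iterated in [hterm_sum],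
    shifts of [a] in [hlterm_sum]. *)
Lemma hterm_bound (a w p : C) :
  (Cmod p < 1)%R -> qpoch_regular (a * w) p ->
  exists B, (0 <= B)%R /\ forall M N k,
    (Cmod (hterm (a * cpow p M) (w * cpow p N) p k) <= B * Cmod (w * cpow p N) ^ k)%R.
Proof.
  intros Hp Haw.
  destruct (qpoch_Cmod_ge _ p Hp Haw) as [c [Hc H1]].
  destruct (qpoch_Cmod_ge p p Hp (qpoch_regular_small p p Hp Hp)) as [d [Hd H2]].
  set (E := exp (Cmod a / (1 - Cmod p))).
  assert (HE : (0 < E)%R) by apply exp_pos.
  exists (E / (c * d))%R. split.
  - left. apply Rdiv_lt_0_compat; trivial. now apply Rmult_lt_0_compat.
  - intros M N k. unfold hterm.
    replace (E / (c * d) * Cmod (w * cpow p N) ^ k)%R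
      with (Cmod (w * cpow p N) ^ k * E / (c * d))%R by (field; lra).
    apply Cmod_div_le.
    + now apply Rmult_lt_0_compat.
    + rewrite Cmod_mult. apply Rmult_le_compat; try apply Cmod_ge_0.
      * now apply Cmod_gauss_le.
      * now apply qpoch_Cmod_le.
    + rewrite Cmod_mult. specialize (H1 (M + N)%nat k). specialize (H2 O k).
      simpl in H2. rewrite Cmult_1_r in H2.
      replace (a * cpow p M * (w * cpow p N)) with (a * w * cpow p (M + N))
        by (rewrite cpow_add; ring).
      apply Rmult_le_compat; lra.
Qed.

Lemma qpoch_shift (a p : C) (n : nat) : 1 - a <> 0 ->
  qpoch (a * p) p n = qpoch a p n * (1 - a * cpow p n) / (1 - a).
Proof.
  intros Ha. pose proof (qpoch_head a p n) as H. simpl in H. rewrite H. field. exact Ha.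
Qed.

Lemma qpoch_regular_0 (a p : C) : qpoch_regular a p -> 1 - a <> 0.
Proof. intros H. specialize (H O). simpl in H. now rewrite Cmult_1_r in H. Qed.

Lemma hterm_succ (a w p : C) (k : nat) :
  (Cmod p < 1)%R -> qpoch_regular (a * w) p ->
  hterm a w p (S k) = hterm a w p k * - (w * cpow p k) * (1 - a * cpow p k)
                      / ((1 - a * w * cpow p k) * (1 - p * cpow p k)).
Proof.
  intros Hp Haw. unfold hterm. simpl. field.
  pose proof (qpoch_regular_small p p Hp Hp) as Hpp.
  repeat split; try (now apply qpoch_neq_0); auto.
Qed.

Lemma hterm_shift_w (a w p : C) (k : nat) :
  (Cmod p < 1)%R -> qpoch_regular (a * w) p ->
  hterm a (w * p) p k
  = hterm a w p k * cpow p k * (1 - a * w) / (1 - a * w * cpow p k).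
Proof.
  intros Hp Haw. unfold hterm.
  pose proof (qpoch_regular_0 _ _ Haw) as H0.
  rewrite gauss_shift. replace (a * (w * p)) with (a * w * p) by ring.
  rewrite qpoch_shift by trivial. field.
  pose proof (qpoch_regular_small p p Hp Hp) as Hpp.
  repeat split; try (now apply qpoch_neq_0); auto.
Qed.

Lemma hterm_shift_a (a w p : C) (k : nat) :
  (Cmod p < 1)%R -> qpoch_regular (a * w) p -> 1 - a <> 0 ->
  hterm (a * p) w p k
  = hterm a w p k * (1 - a * cpow p k) / (1 - a)
    * (1 - a * w) / (1 - a * w * cpow p k).
Proof.
  intros Hp Haw Ha. unfold hterm.
  pose proof (qpoch_regular_0 _ _ Haw) as H0.
  replace (a * p * w) with (a * w * p) by ring.
  rewrite !qpoch_shift by trivial. field.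
  pose proof (qpoch_regular_small p p Hp Hp) as Hpp.
  repeat split; try (now apply qpoch_neq_0); auto.
Qed.

Lemma Clim_0_geom (u : nat -> C) (B r : R) :
  (0 <= r < 1)%R -> (forall n, (Cmod (u n) <= B * r ^ n)%R) -> Clim u 0.
Proof.
  intros Hr H. apply Clim_squeeze with (fun n => B * r ^ n)%R.
  - intros n. replace (u n - 0) with (u n) by ring. apply H.
  - replace 0%R with (B * 0)%R by ring. apply is_lim_seq_mult'.
    + apply is_lim_seq_const.
    + apply is_lim_seq_geom. rewrite Rabs_pos_eq; lra.
Qed.

Lemma hterm_lim_0 (a w p : C) :
  (Cmod p < 1)%R -> (Cmod w < 1)%R -> qpoch_regular (a * w) p ->
  Clim (hterm a w p) 0.
Proof.
  intros Hp Hw Haw. destruct (hterm_bound a w p Hp Haw) as [B [_ HB]].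
  apply Clim_0_geom with B (Cmod w).
  - split; trivial. apply Cmod_ge_0.
  - intros k. specialize (HB O O k). simpl in HB. now rewrite !Cmult_1_r in HB.
Qed.

Lemma hterm_ex (a w p : C) :
  (Cmod p < 1)%R -> (Cmod w < 1)%R -> qpoch_regular (a * w) p ->
  exists l, Cseries (hterm a w p) l.
Proof.
  intros Hp Hw Haw. destruct (hterm_bound a w p Hp Haw) as [B [_ HB]].
  apply Cseries_geom_ex with B (Cmod w).
  - split; trivial. apply Cmod_ge_0.
  - intros k. specialize (HB O O k). simpl in HB. now rewrite !Cmult_1_r in HB.
Qed.

Lemma hterm_0 (a w p : C) : hterm a w p 0 = 1.
Proof. unfold hterm. simpl. field. Qed.

Lemma hterm_sum_shift_w (a w p l l' : C) :
  (Cmod p < 1)%R -> (Cmod w < 1)%R -> qpoch_regular (a * w) p ->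
  Cseries (hterm a w p) l -> Cseries (hterm a (w * p) p) l' ->
  (1 - a * w) * l = (1 - w) * l'.
Proof.
  intros Hp Hw Haw Hl Hl'.
  (* Telescoping certificate: [U (S k) - U k] is the k-th term of the relation. It vanishes at
     [k = 0] because of [1 - p^k], and at infinity because [T_k] does. *)
  set (U := fun k => - (1 - a * w) * (hterm a w p k * (1 - cpow p k))).
  assert (HU : Clim U 0).
  { replace (RtoC 0) with (- (1 - a * w) * (0 * (1 - 0))) by ring.
    apply Clim_scal, Clim_mult; [now apply hterm_lim_0|].
    apply Clim_minus; [apply Clim_const | now apply Clim_cpow]. }
  apply Cseries_telescope in HU.
  replace (0 - U O) with (RtoC 0) in HU by (unfold U; simpl; ring).
  assert (H := Cseries_minus _ _ _ _ (Cseries_scal (1 - a * w) _ _ Hl)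
                 (Cseries_scal (1 - w) _ _ Hl')).
  assert (E : (1 - a * w) * l - (1 - w) * l' = 0).
  { apply (Cseries_unique _ _ _ H). apply Cseries_ext with (2 := HU). intros k. unfold U.
    rewrite hterm_succ, hterm_shift_w by trivial. simpl. field.
    pose proof (qpoch_regular_small p p Hp Hp k). split; auto. }
  replace ((1 - a * w) * l) with ((1 - a * w) * l - (1 - w) * l' + (1 - w) * l') by ring.
  rewrite E. ring.
Qed.

Lemma Cmod_shift_lt_1 (w p : C) (N : nat) :
  (Cmod p < 1)%R -> (Cmod w < 1)%R -> (Cmod (w * cpow p N) < 1)%R.
Proof. intros Hp Hw. pose proof (Cmod_mult_cpow_le w p N Hp). lra. Qed.

(** After N shifts, [(aw;p)_N l = (w;p)_N l'] with [l'] the sum at [w p^N]. Every term of [l'] but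
    the first, which is 1, carries a factor of size [|w p^N|], so [l' - 1] is [O(|p|^N)]. *)
Lemma hterm_sum (a w p : C) :
  (Cmod p < 1)%R -> (Cmod w < 1)%R -> qpoch_regular (a * w) p ->
  Cseries (hterm a w p) (qpoch_inf w p / qpoch_inf (a * w) p).
Proof.
  intros Hp Hw Haw. destruct (hterm_ex a w p Hp Hw Haw) as [l Hl].
  destruct (hterm_bound a w p Hp Haw) as [B [HB0 HB]].
  assert (Hit : forall N, exists l', Cseries (hterm a (w * cpow p N) p) l'
                            /\ qpoch (a * w) p N * l = qpoch w p N * l').
  { induction N as [|N [l' [Hl' E]]].
    - exists l. simpl. rewrite Cmult_1_r. split; trivial.
    - pose proof (Cmod_shift_lt_1 w p N Hp Hw) as HwN.
      assert (HN : qpoch_regular (a * (w * cpow p N)) p).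
      { rewrite Cmult_assoc. now apply qpoch_regular_shift. }
      assert (HSN : qpoch_regular (a * (w * cpow p (S N))) p).
      { rewrite Cmult_assoc. now apply qpoch_regular_shift. }
      destruct (hterm_ex a (w * cpow p (S N)) p Hp (Cmod_shift_lt_1 w p (S N) Hp Hw) HSN)
        as [l'' Hl''].
      exists l''. split; trivial.
      replace (w * cpow p (S N)) with (w * cpow p N * p) in Hl'' by (simpl; ring).
      pose proof (hterm_sum_shift_w _ _ _ _ _ Hp HwN HN Hl' Hl'') as E'.
      simpl. rewrite <- (Cmult_assoc (qpoch w p N)), <- E'.
      replace (qpoch (a * w) p N * (1 - a * w * cpow p N) * l)
        with (qpoch (a * w) p N * l * (1 - a * w * cpow p N)) by ring.
      rewrite E. ring. }
  assert (Hlim : Clim (fun N => qpoch (a * w) p N * l - qpoch w p N) 0).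
  { apply Clim_0_geom
      with (exp (Cmod w / (1 - Cmod p)) * (Cmod w * B / (1 - Cmod w)))%R (Cmod p).
    { split; trivial. apply Cmod_ge_0. }
    intros N. destruct (Hit N) as [l' [Hl' E]]. rewrite E.
    replace (qpoch w p N * l' - qpoch w p N) with (qpoch w p N * (l' - 1)) by ring.
    rewrite Cmod_mult, Rmult_assoc.
    apply Rmult_le_compat; try apply Cmod_ge_0.
    - pose proof (qpoch_Cmod_le w p 0 N Hp) as Hu. simpl in Hu. now rewrite Cmult_1_r in Hu.
    - apply Cseries_decr_1 in Hl'. rewrite hterm_0 in Hl'.
      replace (Cmod w * B / (1 - Cmod w) * Cmod p ^ N)%R
        with (B * (Cmod w * Cmod p ^ N) / (1 - Cmod w))%R by (field; lra).
      pose proof (Cmod_ge_0 w) as Hw0.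
      pose proof (pow_le (Cmod p) N (Cmod_ge_0 p)) as HpN.
      apply Cseries_geom_le with (4 := Hl'); try (split; trivial).
      + apply Rmult_le_pos; trivial. now apply Rmult_le_pos.
      + intros k. specialize (HB O N (S k)). simpl cpow at 1 in HB.
        rewrite Cmult_1_r in HB. eapply Rle_trans; [exact HB|].
        simpl pow. rewrite <- Rmult_assoc.
        rewrite <- Cmod_cpow with (x := p), <- Cmod_mult.
        apply Rmult_le_compat_l.
        * apply Rmult_le_pos; trivial. apply Cmod_ge_0.
        * apply pow_incr. split; [apply Cmod_ge_0 | now apply Cmod_mult_cpow_le]. }
  pose proof (Clim_minus _ _ _ _ (Clim_mult _ _ _ _ (qpoch_lim (a * w) p Hp) (Clim_const l))
                (qpoch_lim w p Hp)) as Hlim'.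
  pose proof (Clim_unique _ _ _ Hlim' Hlim) as E.
  pose proof (qpoch_inf_neq_0 _ _ Hp Haw) as Hnz.
  replace (qpoch_inf w p / qpoch_inf (a * w) p) with l; trivial.
  replace (qpoch_inf w p) with (qpoch_inf (a * w) p * l - (qpoch_inf (a * w) p * l - qpoch_inf w p)) by ring.
  rewrite E. field. exact Hnz.
Qed.

(** * The 1phi1 series weighted by [p^k / (1 - a p^k)] *)

Definition lambert_term (a w p : C) (n : nat) : C := cpow w n / (1 - a * cpow p n).

Definition hlterm (a w p : C) (k : nat) : C :=
  hterm a w p k * cpow p k / (1 - a * cpow p k).

Lemma hlterm_bound (a w p : C) :
  (Cmod p < 1)%R -> (Cmod w < 1)%R -> qpoch_regular a p -> qpoch_regular (a * w) p ->
  exists B, (0 <= B)%R /\ forall M k,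
    (Cmod (hlterm (a * cpow p M) w p k) <= B * Cmod w ^ k)%R.
Proof.
  intros Hp Hw Ha Haw. destruct (hterm_bound a w p Hp Haw) as [B [HB0 HB]].
  destruct (qpoch_Cmod_ge a p Hp Ha) as [c [Hc Hca]].
  exists (B / c)%R. split; [now apply Rdiv_le_0_compat|]. intros M k. unfold hlterm.
  replace (B / c * Cmod w ^ k)%R with (B * Cmod w ^ k / c)%R by (field; lra).
  apply Cmod_div_le; trivial.
  - specialize (HB M O k). simpl in HB. rewrite Cmult_1_r in HB.
    eapply Rle_trans; [|exact HB]. now apply Cmod_mult_cpow_le.
  - specialize (Hca (M + k)%nat 1%nat). simpl in Hca.
    rewrite cpow_add, Cmult_1_l, Cmult_1_r, Cmult_assoc in Hca. exact Hca.
Qed.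

Lemma hlterm_ex (a w p : C) :
  (Cmod p < 1)%R -> (Cmod w < 1)%R -> qpoch_regular a p -> qpoch_regular (a * w) p ->
  exists l, Cseries (hlterm a w p) l.
Proof.
  intros Hp Hw Ha Haw. destruct (hlterm_bound a w p Hp Hw Ha Haw) as [B [_ HB]].
  apply Cseries_geom_ex with B (Cmod w).
  - split; trivial. apply Cmod_ge_0.
  - intros k. specialize (HB O k). simpl in HB. now rewrite Cmult_1_r in HB.
Qed.

Lemma hlterm_sum_shift (a w p l l' : C) :
  (Cmod p < 1)%R -> (Cmod w < 1)%R -> qpoch_regular a p -> qpoch_regular (a * w) p ->
  Cseries (hlterm a w p) l -> Cseries (hlterm (a * p) w p) l' ->
  l = qpoch_inf w p / qpoch_inf (a * w) p / (1 - a) + w / (1 - a * w) * l'.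
Proof.
  intros Hp Hw Ha Haw Hl Hl'.
  pose proof (qpoch_regular_0 _ _ Ha) as Ha0.
  pose proof (qpoch_regular_0 _ _ Haw) as Haw0.
  set (P := qpoch_inf w p / qpoch_inf (a * w) p).
  (* Certificate of an inhomogeneous relation: besides the two weighted sums it involves [T_k]
     itself, whose sum [P] is known from [hterm_sum]. *)
  set (U := fun k => hterm a w p k * ((1 - a * w) * ((1 - cpow p k) / (1 - a * cpow p k)))).
  assert (HU : Clim U 0).
  { destruct (qpoch_Cmod_ge a p Hp Ha) as [c [Hc Hca]].
    destruct (hterm_bound a w p Hp Haw) as [B [HB0 HB]].
    apply Clim_0_geom with (B * (Cmod (1 - a * w) * (2 / c)))%R (Cmod w).
    { split; trivial. apply Cmod_ge_0. }
    intros k. unfold U. rewrite !(Cmod_mult (hterm a w p k)), Cmod_mult.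
    replace (B * (Cmod (1 - a * w) * (2 / c)) * Cmod w ^ k)%R
      with (B * Cmod w ^ k * (Cmod (1 - a * w) * (2 / c)))%R by ring.
    specialize (HB O O k). simpl in HB. rewrite !Cmult_1_r in HB.
    specialize (Hca k 1%nat). simpl in Hca. rewrite Cmult_1_l, Cmult_1_r in Hca.
    apply Rmult_le_compat; trivial; try apply Cmod_ge_0.
    - apply Rmult_le_pos; apply Cmod_ge_0.
    - apply Rmult_le_compat_l; [apply Cmod_ge_0|]. apply Cmod_div_le; trivial.
      eapply Rle_trans; [apply (Cmod_triangle 1 (- cpow p k))|].
      rewrite Cmod_1, Cmod_opp. pose proof (Cmod_cpow_le_1 p k Hp). lra. }
  apply Cseries_telescope in HU.
  replace (0 - U O) with (RtoC 0) in HU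
    by (unfold U; simpl; field; exact Ha0).
  assert (H := Cseries_minus _ _ _ _
    (Cseries_scal (1 - a) _ _ (Cseries_minus _ _ _ _
       (Cseries_scal (1 - a * w) _ _ Hl) (Cseries_scal w _ _ Hl')))
    (Cseries_scal (1 - a * w) _ _ (hterm_sum a w p Hp Hw Haw))).
  fold P in H.
  assert (E : (1 - a) * ((1 - a * w) * l - w * l') - (1 - a * w) * P = 0).
  { apply (Cseries_unique _ _ _ H). apply Cseries_ext with (2 := HU). intros k. unfold U, hlterm.
    rewrite hterm_succ, hterm_shift_a by trivial.
    pose proof (Ha (S k)) as HaS.
    simpl in HaS |- *. field.
    pose proof (qpoch_regular_small p p Hp Hp k).
    repeat split; auto. rewrite <- Cmult_assoc. exact HaS. }
  replace l with (((1 - a) * ((1 - a * w) * l - w * l') - (1 - a * w) * P)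
                  / ((1 - a) * (1 - a * w)) + (P / (1 - a) + w / (1 - a * w) * l'))
    by (field; auto).
  rewrite E. field. auto.
Qed.

(** Each shift of [a] releases one term of the Lambert series. At stage N the released term has
    denominator [(a w p^N;p)_inf] and the accumulated coefficient is [w^N / (aw;p)_N]; together they
    give [P w^N / (1 - a p^N)], with the same [P] at every stage. The remainder is [O(|w|^N)]. *)
Lemma hlterm_sum (a w p g : C) :
  (Cmod p < 1)%R -> (Cmod w < 1)%R -> qpoch_regular a p -> qpoch_regular (a * w) p ->
  Cseries (lambert_term a w p) g ->
  Cseries (hlterm a w p) (qpoch_inf w p / qpoch_inf (a * w) p * g).
Proof.
  intros Hp Hw Ha Haw Hg.
  destruct (hlterm_ex a w p Hp Hw Ha Haw) as [l Hl].
  set (P := qpoch_inf w p / qpoch_inf (a * w) p).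
  replace (P * g) with l; trivial.
  assert (Hreg : forall N, qpoch_regular (a * cpow p N * w) p).
  { intros N. replace (a * cpow p N * w) with (a * w * cpow p N) by ring.
    now apply qpoch_regular_shift. }
  assert (Hinf : forall N, qpoch_inf (a * w) p
                 = qpoch (a * w) p N * qpoch_inf (a * w * cpow p N) p).
  { induction N as [|N IH].
    - simpl. rewrite Cmult_1_r, Cmult_1_l. reflexivity.
    - rewrite IH, (qpoch_inf_head (a * w * cpow p N)) by trivial. simpl.
      replace (a * w * cpow p N * p) with (a * w * (p * cpow p N)) by ring. ring. }
  assert (Hit : forall N, exists l', Cseries (hlterm (a * cpow p N) w p) l'
     /\ l = P * csum (lambert_term a w p) N + cpow w N / qpoch (a * w) p N * l').
  { induction N as [|N [l' [Hl' E]]].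
    - exists l. simpl. rewrite Cmult_1_r. split; trivial. field.
    - destruct (hlterm_ex (a * cpow p (S N)) w p Hp Hw
                  (qpoch_regular_shift _ _ _ Ha) (Hreg (S N))) as [l'' Hl''].
      exists l''. split; trivial.
      replace (a * cpow p (S N)) with (a * cpow p N * p) in Hl'' by (simpl; ring).
      pose proof (hlterm_sum_shift _ _ _ _ _ Hp Hw (qpoch_regular_shift _ _ N Ha)
                    (Hreg N) Hl' Hl'') as E'.
      rewrite E, E'. unfold P. rewrite (Hinf N). unfold lambert_term. simpl.
      replace (a * cpow p N * w) with (a * w * cpow p N) by ring. field.
      pose proof (Haw N). pose proof (Ha N).
      pose proof (qpoch_neq_0 _ _ N Haw).
      pose proof (qpoch_inf_neq_0 _ _ Hp (qpoch_regular_shift _ _ N Haw)).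
      repeat split; auto. }
  destruct (hlterm_bound a w p Hp Hw Ha Haw) as [B [HB0 HB]].
  destruct (qpoch_Cmod_ge _ p Hp Haw) as [c [Hc Hca]].
  assert (Hlim : Clim (fun N => l - P * csum (lambert_term a w p) N) 0).
  { apply Clim_0_geom with (/ c * (B / (1 - Cmod w)))%R (Cmod w).
    { split; trivial. apply Cmod_ge_0. }
    intros N. destruct (Hit N) as [l' [Hl' E]].
    replace (l - P * csum (lambert_term a w p) N) with (cpow w N / qpoch (a * w) p N * l')
      by (rewrite E at 1; ring).
    rewrite Cmod_mult.
    replace (/ c * (B / (1 - Cmod w)) * Cmod w ^ N)%R
      with (Cmod w ^ N / c * (B / (1 - Cmod w)))%R by (field; lra).
    specialize (Hca O N). simpl in Hca. rewrite Cmult_1_r in Hca.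
    apply Rmult_le_compat; try apply Cmod_ge_0.
    - apply Cmod_div_le; trivial. right. apply Cmod_cpow.
    - apply Cseries_geom_le with (4 := Hl'); trivial.
      split; trivial. apply Cmod_ge_0. }
  pose proof (Clim_minus _ _ _ _ (Clim_const l) (Clim_scal P _ _ Hg)) as Hlim'.
  pose proof (Clim_unique _ _ _ Hlim' Hlim) as E.
  replace l with (l - P * g + P * g) by ring. rewrite E. ring.
Qed.

(** * Functional equations and symmetry of the Lambert series G *)

Lemma Cseries_geom (w : C) : (Cmod w < 1)%R -> Cseries (cpow w) (/ (1 - w)).
Proof.
  intros Hw. pose proof (one_minus_neq_0 w Hw) as H0.
  assert (HU := Cseries_telescope _ _ (Clim_scal (- / (1 - w)) _ _ (Clim_cpow w Hw))).
  simpl in HU. replace (/ (1 - w)) with (- / (1 - w) * 0 - - / (1 - w) * 1) by ring.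
  apply Cseries_ext with (2 := HU). intros n. simpl. field. exact H0.
Qed.

Lemma lambert_ex (a w p : C) :
  (Cmod p < 1)%R -> (Cmod w < 1)%R -> qpoch_regular a p ->
  exists g, Cseries (lambert_term a w p) g.
Proof.
  intros Hp Hw Ha. destruct (qpoch_Cmod_ge a p Hp Ha) as [c [Hc Hca]].
  apply Cseries_geom_ex with (/ c)%R (Cmod w).
  - split; trivial. apply Cmod_ge_0.
  - intros n. replace (/ c * Cmod w ^ n)%R with (Cmod w ^ n / c)%R by (field; lra).
    apply Cmod_div_le; trivial.
    + right. apply Cmod_cpow.
    + specialize (Hca n 1%nat). simpl in Hca. now rewrite Cmult_1_l, Cmult_1_r in Hca.
Qed.

Lemma lambert_shift_a (a w p g g' : C) : qpoch_regular a p ->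
  Cseries (lambert_term a w p) g -> Cseries (lambert_term (a * p) w p) g' ->
  g = / (1 - a) + w * g'.
Proof.
  intros Ha Hg Hg'. pose proof (qpoch_regular_0 _ _ Ha) as Ha0.
  assert (E : g - lambert_term a w p 0 = w * g').
  { apply Cseries_unique with (fun n => lambert_term a w p (S n)).
    - now apply Cseries_decr_1.
    - apply Cseries_ext with (2 := Cseries_scal w _ _ Hg'). intros n.
      unfold lambert_term. simpl. rewrite Cmult_assoc. field.
      pose proof (Ha (S n)) as H. simpl in H. now rewrite Cmult_assoc in H. }
  rewrite <- E. unfold lambert_term. simpl. field. exact Ha0.
Qed.

(** Termwise, [w^n / (1 - a p^n) = w^n + a (w p)^n / (1 - a p^n)]. *)
Lemma lambert_shift_w (a w p g g' : C) : (Cmod w < 1)%R -> qpoch_regular a p ->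
  Cseries (lambert_term a w p) g -> Cseries (lambert_term a (w * p) p) g' ->
  g = / (1 - w) + a * g'.
Proof.
  intros Hw Ha Hg Hg'. apply (Cseries_unique _ _ _ Hg).
  apply Cseries_ext
    with (2 := Cseries_plus _ _ _ _ (Cseries_geom w Hw) (Cseries_scal a _ _ Hg')).
  intros n. unfold lambert_term. rewrite cpow_mult_base. field. apply Ha.
Qed.

(** Shifting both parameters leaves [1/(1-w) + a/(1-a) = 1/(1-w) + 1/(1-a) - 1], symmetric in [a]
    and [w], as is the coefficient [a w p]. *)
Lemma lambert_shift (a w p g g' : C) :
  (Cmod p < 1)%R -> (Cmod w < 1)%R -> qpoch_regular a p ->
  Cseries (lambert_term a w p) g -> Cseries (lambert_term (a * p) (w * p) p) g' ->
  g = / (1 - w) + a / (1 - a) + a * w * p * g'.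
Proof.
  intros Hp Hw Ha Hg Hg'.
  assert (Hwp : (Cmod (w * p) < 1)%R).
  { pose proof (Cmod_shift_lt_1 w p 1 Hp Hw) as H. simpl in H. now rewrite Cmult_1_r in H. }
  destruct (lambert_ex a (w * p) p Hp Hwp Ha) as [h Hh].
  rewrite (lambert_shift_w _ _ _ _ _ Hw Ha Hg Hh).
  rewrite (lambert_shift_a _ _ _ _ _ Ha Hh Hg').
  field. split; [now apply qpoch_regular_0 with p | now apply one_minus_neq_0].
Qed.

Lemma lambert_Cmod_le (a w p g : C) (N : nat) :
  (Cmod p < 1)%R -> (Cmod a < 1)%R -> (Cmod w < 1)%R ->
  Cseries (lambert_term (a * cpow p N) (w * cpow p N) p) g ->
  (Cmod g <= / (1 - Cmod a) / (1 - Cmod w))%R.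
Proof.
  intros Hp Ha Hw Hg. apply Cseries_geom_le with (4 := Hg).
  - split; trivial. apply Cmod_ge_0.
  - left. apply Rinv_0_lt_compat. lra.
  - intros k. replace (/ (1 - Cmod a) * Cmod w ^ k)%R with (Cmod w ^ k / (1 - Cmod a))%R
      by (field; lra).
    apply Cmod_div_le; [lra| |].
    + rewrite Cmod_cpow. apply pow_incr. split; [apply Cmod_ge_0 | now apply Cmod_mult_cpow_le].
    + eapply Rle_trans; [|apply Cmod_one_minus_ge].
      pose proof (Cmod_mult_cpow_le (a * cpow p N) p k Hp).
      pose proof (Cmod_mult_cpow_le a p N Hp). lra.
Qed.

(** Both sides equal the double series [sum a^m w^n p^(mn)], but no interchange of summation is
    made. The symmetric parts of [lambert_shift] cancel in [g - h], so each double shift multiplies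
    the difference by a factor of modulus at most [|p|], while the shifted values stay bounded. *)
Lemma lambert_sym (a w p g h : C) :
  (Cmod p < 1)%R -> (Cmod a < 1)%R -> (Cmod w < 1)%R ->
  Cseries (lambert_term a w p) g -> Cseries (lambert_term w a p) h -> g = h.
Proof.
  intros Hp Ha Hw Hg Hh.
  assert (Hit : forall N, exists c g' h',
     Cseries (lambert_term (a * cpow p N) (w * cpow p N) p) g' /\
     Cseries (lambert_term (w * cpow p N) (a * cpow p N) p) h' /\
     g - h = c * (g' - h') /\ (Cmod c <= Cmod p ^ N)%R).
  { induction N as [|N (c & g' & h' & Hg' & Hh' & E & Hc)].
    - exists 1, g, h. simpl. rewrite !Cmult_1_r, Cmod_1, Cmult_1_l.
      repeat split; trivial. lra.
    - assert (HS : forall x, (Cmod x < 1)%R -> (Cmod (x * cpow p (S N)) < 1)%R)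
        by (intros; now apply Cmod_shift_lt_1).
      assert (HN : forall x, (Cmod x < 1)%R -> (Cmod (x * cpow p N) < 1)%R)
        by (intros; now apply Cmod_shift_lt_1).
      pose proof (fun x Hx => qpoch_regular_small _ p Hp (HS x Hx)) as RS.
      pose proof (fun x Hx => qpoch_regular_small _ p Hp (HN x Hx)) as RN.
      destruct (lambert_ex _ _ p Hp (HS w Hw) (RS a Ha)) as [g'' Hg''].
      destruct (lambert_ex _ _ p Hp (HS a Ha) (RS w Hw)) as [h'' Hh''].
      exists (c * (a * cpow p N * (w * cpow p N) * p)), g'', h''.
      split; [|split; [|split]]; trivial.
      + rewrite E.
        assert (ES : forall x, x * cpow p (S N) = x * cpow p N * p)
          by (intros; simpl; ring).
        rewrite !ES in Hg'', Hh''.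
        rewrite (lambert_shift _ _ _ _ _ Hp (HN w Hw) (RN a Ha) Hg' Hg'').
        rewrite (lambert_shift _ _ _ _ _ Hp (HN a Ha) (RN w Hw) Hh' Hh'').
        field. split; apply one_minus_neq_0; auto.
      + rewrite !(Cmod_mult c), Cmod_mult, (Cmod_mult (a * cpow p N)). simpl.
        rewrite (Rmult_comm (Cmod p)).
        pose proof (HN a Ha). pose proof (HN w Hw).
        pose proof (Cmod_ge_0 (a * cpow p N)). pose proof (Cmod_ge_0 (w * cpow p N)).
        pose proof (Cmod_ge_0 p).
        apply Rmult_le_compat; trivial; try apply Cmod_ge_0.
        * apply Rmult_le_pos; trivial. now apply Rmult_le_pos.
        * assert (Cmod (a * cpow p N) * Cmod (w * cpow p N) <= 1 * 1)%R
            by (apply Rmult_le_compat; lra).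
          nra. }
  assert (H0 : Clim (fun _ => g - h) 0).
  { apply Clim_0_geom
      with (/ (1 - Cmod a) / (1 - Cmod w) + / (1 - Cmod w) / (1 - Cmod a))%R (Cmod p).
    { split; trivial. apply Cmod_ge_0. }
    intros N. destruct (Hit N) as (c & g' & h' & Hg' & Hh' & E & Hc).
    rewrite E, Cmod_mult, Rmult_comm.
    apply Rmult_le_compat; try apply Cmod_ge_0; trivial.
    eapply Rle_trans; [apply (Cmod_triangle g' (- h'))|]. rewrite Cmod_opp.
    apply Rplus_le_compat.
    - exact (lambert_Cmod_le _ _ _ _ _ Hp Ha Hw Hg').
    - exact (lambert_Cmod_le _ _ _ _ _ Hp Hw Ha Hh'). }
  pose proof (Clim_unique _ _ _ (Clim_const (g - h)) H0) as E.
  replace g with (g - h + h) by ring. rewrite E. ring.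
Qed.

(** * The two-square theorem from a finite identity *)

Lemma C2_nz : RtoC 2 <> 0.
Proof. intros H. injection H. lra. Qed.

Section TwoSquares.

Variable q : C.
Hypothesis hq : (Cmod q < 1)%R.

Let Q := q * q.

Definition usq (n : nat) : C := qpoch (- q) Q n / qpoch Q Q n.
Definition vsq (n : nat) : C := qpoch q Q n / qpoch (- Q) Q n.
(** The formula is invariant under [j -> -j], since [(-q)^(-j) / (1 + Q^(-j)) = (-q)^j / (1 + Q^j)].
    Thus twice the sum over [0 <= j <= N] minus the term [j = 0] is a sum over [-N <= j <= N].
    Beyond [j = N] the truncated subtraction makes the values meaningless. *)
Definition ssq (N j : nat) : C :=
  cpow (- q) j * usq (N + j) * usq (N - j) / (1 + cpow Q j).

(* WZ mate of [ssq], with index shifted by one. *)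
Definition gsq (N i : nat) : C :=
  q * (1 + q * Q * (cpow Q N * cpow Q N)) / ((1 + q * cpow Q N) * (1 - Q * cpow Q N))
  * cpow (- q) i * (1 + q * cpow Q i) * cpow Q (N - i) * usq (N + S i) * usq (N - i).

Lemma Cmod_sq_lt_1 : (Cmod Q < 1)%R.
Proof. unfold Q. rewrite Cmod_mult. pose proof (Cmod_ge_0 q). nra. Qed.

Lemma mult_cpow_sq_lt_1 (x : C) (n : nat) :
  (Cmod x < 1)%R -> (Cmod (x * cpow Q n) < 1)%R.
Proof. apply Cmod_shift_lt_1, Cmod_sq_lt_1. Qed.

Lemma regular_m1 : qpoch_regular (- (1)) Q.
Proof.
  intros [|n].
  - simpl. replace (1 - - (1) * 1) with (RtoC 2).
    + apply C2_nz.
    + ring.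
  - replace (1 - - (1) * cpow Q (S n)) with (1 + Q * cpow Q n) by (simpl; ring).
    apply one_plus_neq_0, mult_cpow_sq_lt_1, Cmod_sq_lt_1.
Qed.

Lemma one_plus_cpow_sq_neq_0 (n : nat) : 1 + cpow Q n <> 0.
Proof.
  replace (1 + cpow Q n) with (1 - - (1) * cpow Q n) by ring. apply regular_m1.
Qed.

Lemma usq_succ (n : nat) :
  usq (S n) = usq n * (1 + q * cpow Q n) / (1 - Q * cpow Q n).
Proof.
  pose proof (qpoch_regular_small Q Q Cmod_sq_lt_1 Cmod_sq_lt_1) as HQ.
  unfold usq. simpl. field. split; [now apply qpoch_neq_0 | apply HQ].
Qed.

Lemma vsq_succ (n : nat) :
  vsq (S n) = vsq n * (1 - q * cpow Q n) / (1 + Q * cpow Q n).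
Proof.
  assert (HQ : qpoch_regular (- Q) Q).
  { apply qpoch_regular_small; rewrite ?Cmod_opp; apply Cmod_sq_lt_1. }
  unfold vsq. simpl. replace (1 - - Q * cpow Q n) with (1 + Q * cpow Q n) by ring.
  field. split; [now apply qpoch_neq_0|].
  apply one_plus_neq_0, mult_cpow_sq_lt_1, Cmod_sq_lt_1.
Qed.

Lemma usq_0 : usq 0 = 1.
Proof. unfold usq. simpl. field. Qed.

(** Boundary case at 0: the reflection [j -> -j] makes the mate at 0 the opposite of the mate at 1,
    so their difference is twice the latter, which is [gsq N 0] after the index shift. *)
Lemma ssq_wz_0 (N : nat) :
  (1 + Q * cpow Q N) * (1 + Q * cpow Q N) * ssq (S N) 0
  - (1 - q * cpow Q N) * (1 - q * cpow Q N) * ssq N 0 = 2 * gsq N 0.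
Proof.
  unfold ssq, gsq. rewrite !Nat.add_0_r, !Nat.sub_0_r, Nat.add_1_r, !usq_succ.
  simpl cpow. generalize (usq N). intros u.
  pose proof (one_plus_neq_0 _ (mult_cpow_sq_lt_1 q N hq)) as H1.
  pose proof (one_minus_neq_0 _ (mult_cpow_sq_lt_1 Q N Cmod_sq_lt_1)) as H2.
  pose proof (one_plus_cpow_sq_neq_0 0) as H3. simpl in H3.
  unfold Q in *. generalize dependent (cpow (q * q) N). intros y H1 H2.
  field. auto.
Qed.

(** Boundary case at the top: neither the summand of level [N] at [N+1] nor the next mate
    contributes. *)
Lemma ssq_wz_last (N : nat) :
  (1 + Q * cpow Q N) * (1 + Q * cpow Q N) * ssq (S N) (S N) = - gsq N N.
Proof.
  unfold ssq, gsq. rewrite !Nat.sub_diag, usq_0.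
  replace (S N + S N)%nat with (S (N + S N)) by lia. rewrite usq_succ.
  generalize (usq (N + S N)). intros u.
  pose proof (one_plus_neq_0 _ (mult_cpow_sq_lt_1 q N hq)) as H1.
  pose proof (one_minus_neq_0 _ (mult_cpow_sq_lt_1 Q N Cmod_sq_lt_1)) as H2.
  pose proof (one_minus_neq_0 _ (mult_cpow_sq_lt_1 Q (N + S N) Cmod_sq_lt_1)) as H4.
  pose proof (one_plus_cpow_sq_neq_0 (S N)) as H3.
  rewrite cpow_add in *. simpl cpow in *.
  unfold Q in *. generalize dependent (cpow (q * q) N). intros y H1 H2 H4 H3.
  field. auto.
Qed.

Lemma ssq_wz (N i : nat) : (i < N)%nat ->
  (1 + Q * cpow Q N) * (1 + Q * cpow Q N) * ssq (S N) (S i)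
  - (1 - q * cpow Q N) * (1 - q * cpow Q N) * ssq N (S i) = gsq N (S i) - gsq N i.
Proof.
  (* Writing [N = i + 1 + m] removes truncated subtraction and turns every power into a monomial in
     [q], [Q^i], [Q^m] and [(-q)^i], so that [field] decides a rational identity. *)
  intros Hi. replace N with (S i + (N - S i))%nat by lia.
  generalize (N - S i)%nat. clear N Hi. intros m.
  set (N := (S i + m)%nat).
  pose proof (one_plus_neq_0 _ (mult_cpow_sq_lt_1 q N hq)) as H1.
  pose proof (one_minus_neq_0 _ (mult_cpow_sq_lt_1 Q N Cmod_sq_lt_1)) as H2.
  pose proof (one_minus_neq_0 _ (mult_cpow_sq_lt_1 Q (N + S i) Cmod_sq_lt_1)) as H4.
  pose proof (one_minus_neq_0 _ (mult_cpow_sq_lt_1 Q m Cmod_sq_lt_1)) as H5.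
  pose proof (one_plus_cpow_sq_neq_0 (S i)) as H3.
  unfold ssq, gsq.
  replace (S N + S i)%nat with (S (N + S i)) by lia.
  replace (N + S (S i))%nat with (S (N + S i)) by lia.
  replace (S N - S i)%nat with (S m) by lia.
  replace (N - S i)%nat with m by lia.
  replace (N - i)%nat with (S m) by lia.
  rewrite !usq_succ.
  generalize (usq (N + S i)) (usq m). intros u u'.
  unfold N in *. rewrite !cpow_add in *. simpl cpow in *.
  generalize (cpow (- q) i). intros e.
  unfold Q in *. generalize dependent (cpow (q * q) i).
  generalize dependent (cpow (q * q) m). intros t H5 X H1 H2 H4 H3.
  field. auto 10.
Qed.

(* Finite form of Jacobi's two-square theorem. *)
Lemma ssq_sum (N : nat) :
  2 * csum (ssq N) (S N) - ssq N 0 = / 2 * (vsq N * vsq N).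
Proof.
  induction N as [|N IH].
  - unfold ssq, vsq. simpl. rewrite usq_0. field.
  - pose proof (one_plus_neq_0 _ (mult_cpow_sq_lt_1 Q N Cmod_sq_lt_1)) as HA.
    rewrite vsq_succ. rewrite csum_shift in IH |- *.
    change (csum (fun k => ssq (S N) (S k)) (S N))
      with (csum (fun k => ssq (S N) (S k)) N + ssq (S N) (S N)).
    set (A := 1 + Q * cpow Q N) in *. set (B := 1 - q * cpow Q N) in *.
    assert (Hmid : A * A * csum (fun k => ssq (S N) (S k)) N
                   - B * B * csum (fun k => ssq N (S k)) N = gsq N N - gsq N 0).
    { rewrite <- csum_telescope.
      transitivity (csum (fun i => A * A * ssq (S N) (S i) + - (B * B) * ssq N (S i)) N).
      - rewrite csum_plus, !csum_scal. ring.
      - apply csum_ext. intros k Hk. rewrite <- ssq_wz by trivial. unfold A, B. ring. }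
    pose proof (ssq_wz_0 N) as H0. pose proof (ssq_wz_last N) as HL.
    fold A B in H0, HL.
    set (s1 := csum (fun k => ssq (S N) (S k)) N) in *.
    set (s0 := csum (fun k => ssq N (S k)) N) in *.
    (* The bilateral sum at level [N+1], times [A * A], is split into the WZ differences plus
       [B * B] times the sum at level [N]. The mates then cancel, leaving the ratio [(B/A)^2], which
       is that of the squares of [vsq]. *)
    replace (2 * (ssq (S N) 0 + (s1 + ssq (S N) (S N))) - ssq (S N) 0)
      with ((A * A * ssq (S N) 0 - B * B * ssq N 0 + 2 * (A * A * s1 - B * B * s0)
             + 2 * (A * A * ssq (S N) (S N))
             + B * B * (2 * (ssq N 0 + s0) - ssq N 0)) / (A * A))
      by (field; exact HA).
    rewrite H0, HL, Hmid, IH. field. auto.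
Qed.

Lemma usq_bound : exists M, (0 <= M)%R /\ forall n, (Cmod (usq n) <= M)%R.
Proof.
  destruct (qpoch_Cmod_ge Q Q Cmod_sq_lt_1
    (qpoch_regular_small Q Q Cmod_sq_lt_1 Cmod_sq_lt_1)) as [c [Hc H]].
  exists (exp (Cmod (- q) / (1 - Cmod Q)) / c)%R. split.
  - apply Rdiv_le_0_compat; trivial. left. apply exp_pos.
  - intros n. apply Cmod_div_le; trivial.
    + pose proof (qpoch_Cmod_le (- q) Q 0 n Cmod_sq_lt_1) as Hu. simpl in Hu.
      now rewrite Cmult_1_r in Hu.
    + specialize (H O n). simpl in H. now rewrite Cmult_1_r in H.
Qed.

Lemma Clim_qpoch_div (a b : C) : qpoch_regular b Q ->
  Clim (fun n => qpoch a Q n / qpoch b Q n) (qpoch_inf a Q / qpoch_inf b Q).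
Proof.
  intros Hb. pose proof Cmod_sq_lt_1 as HQ. apply Clim_mult; [now apply qpoch_lim|].
  destruct (qpoch_Cmod_ge b Q HQ Hb) as [c [Hc H]].
  apply Clim_inv with c; trivial.
  - intros n. specialize (H O n). simpl in H. now rewrite Cmult_1_r in H.
  - now apply qpoch_inf_neq_0.
  - now apply qpoch_lim.
Qed.

(** In the finite identity [usq (N + j)] and [usq (N - j)] both tend to [u], and Tannery's theorem
    applies with ratio [|q|]. The central term tends to [u * u / 2], which accounts for the
    [- 1]. *)
Lemma lambert_two_squares (g : C) :
  Cseries (lambert_term (- (1)) (- q) Q) g ->
  let u := qpoch_inf (- q) Q / qpoch_inf Q Q in
  let v := qpoch_inf q Q / qpoch_inf (- Q) Q in
  u * u * (4 * g - 1) = v * v.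
Proof.
  intros Hg u v. pose proof Cmod_sq_lt_1 as HQ.
  assert (Hu : Clim usq u) by (apply Clim_qpoch_div, qpoch_regular_small; trivial).
  assert (Hv : Clim vsq v).
  { apply Clim_qpoch_div, qpoch_regular_small; rewrite ?Cmod_opp; trivial. }
  destruct usq_bound as [M [HM0 HM]].
  destruct (qpoch_Cmod_ge _ Q HQ regular_m1) as [c [Hc Hca]].
  assert (Hs : forall j, Clim (fun N => ssq N j) (u * u * lambert_term (- (1)) (- q) Q j)).
  { intros j.
    apply Clim_ext with (fun N => usq (N + j) * usq (N - j) * lambert_term (- (1)) (- q) Q j).
    - intros N. unfold ssq, lambert_term.
      replace (1 - - (1) * cpow Q j) with (1 + cpow Q j) by ring.
      field. apply one_plus_cpow_sq_neq_0.
    - apply Clim_mult; [|apply Clim_const].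
      apply Clim_mult; [now apply Clim_incr_n|].
      apply (is_lim_seq_incr_n (fun N => Cmod (usq (N - j) - u)) j).
      apply is_lim_seq_ext with (fun n => Cmod (usq n - u)); [|exact Hu].
      intros n. now rewrite Nat.add_sub. }
  assert (Hsum : Clim (fun N => csum (ssq N) (S N)) (u * u * g)).
  { apply csum_tannery
      with (g := fun j => u * u * lambert_term (- (1)) (- q) Q j)
           (B := (M * M / c)%R) (r := Cmod q); trivial.
    - split; trivial. apply Cmod_ge_0.
    - apply Rdiv_le_0_compat; trivial. now apply Rmult_le_pos.
    - intros N k _. unfold ssq.
      replace (M * M / c * Cmod q ^ k)%R with (Cmod q ^ k * M * M / c)%R by (field; lra).
      apply Cmod_div_le; trivial.
      + rewrite !Cmod_mult, Cmod_cpow, Cmod_opp.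
        pose proof (pow_le (Cmod q) k (Cmod_ge_0 q)).
        repeat apply Rmult_le_compat; trivial; try apply Cmod_ge_0; try lra.
        apply Rmult_le_pos; trivial. apply Cmod_ge_0.
      + specialize (Hca k 1%nat). simpl in Hca. rewrite Cmult_1_l, Cmult_1_r in Hca.
        now replace (1 - - (1) * cpow Q k) with (1 + cpow Q k) in Hca by ring.
    - now apply Cseries_scal. }
  pose proof (Clim_minus _ _ _ _ (Clim_scal 2 _ _ Hsum) (Hs O)) as HL.
  pose proof (Clim_scal (/ 2) _ _ (Clim_mult _ _ _ _ Hv Hv)) as HR.
  assert (E : 2 * (u * u * g) - u * u * lambert_term (- (1)) (- q) Q 0 = / 2 * (v * v)).
  { apply (Clim_unique _ _ _ HL). apply Clim_ext with (2 := HR).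
    intros N. now rewrite ssq_sum. }
  replace (v * v) with (2 * (/ 2 * (v * v))) by field.
  rewrite <- E. unfold lambert_term. simpl.
  replace (1 - - (1) * 1) with (RtoC 2) by ring.
  field.
Qed.

End TwoSquares.

(** * Product dissections and rewriting of the four summands *)

Lemma Clim_double (u : nat -> C) (l : C) : Clim u l -> Clim (fun n => u (2 * n)%nat) l.
Proof.
  intros H. apply (is_lim_seq_subseq (fun n => Cmod (u n - l)) 0%R (fun n => (2 * n)%nat)).
  - apply eventually_subseq. intros n. lia.
  - exact H.
Qed.

Lemma qpoch_succ (a p : C) (n : nat) :
  qpoch a p (S n) = qpoch a p n * (1 - a * cpow p n).
Proof. reflexivity. Qed.

Lemma cpow_double (q : C) (k : nat) : cpow q (2 * k) = cpow (q * q) k.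
Proof. rewrite cpow_mult_base. simpl. rewrite Nat.add_0_r. apply cpow_add. Qed.

Lemma qpoch_even (a p : C) (n : nat) :
  qpoch a p (2 * n) = qpoch a (p * p) n * qpoch (a * p) (p * p) n.
Proof.
  induction n as [|n IH]; [simpl; ring|].
  replace (2 * S n)%nat with (S (S (2 * n))) by lia.
  rewrite !qpoch_succ, IH.
  change (cpow p (S (2 * n))) with (p * cpow p (2 * n)). rewrite cpow_double. ring.
Qed.

Lemma qpoch_opp (a p : C) (n : nat) :
  qpoch a p n * qpoch (- a) p n = qpoch (a * a) (p * p) n.
Proof.
  induction n as [|n IH]; simpl; [ring|]. rewrite <- IH, cpow_mult_base. ring.
Qed.

Lemma qpoch_inf_even (a p : C) : (Cmod p < 1)%R ->
  qpoch_inf a (p * p) * qpoch_inf (a * p) (p * p) = qpoch_inf a p.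
Proof.
  intros Hp. pose proof (Cmod_sq_lt_1 p Hp) as Hpp.
  apply Clim_unique with (fun n => qpoch a p (2 * n)).
  - apply Clim_ext with (fun n => qpoch a (p * p) n * qpoch (a * p) (p * p) n).
    + intros n. now rewrite qpoch_even.
    + apply Clim_mult; now apply qpoch_lim.
  - now apply (Clim_double (qpoch a p)), qpoch_lim.
Qed.

Lemma qpoch_inf_opp (a p : C) : (Cmod p < 1)%R ->
  qpoch_inf a p * qpoch_inf (- a) p = qpoch_inf (a * a) (p * p).
Proof.
  intros Hp. pose proof (Cmod_sq_lt_1 p Hp) as Hpp.
  apply Clim_unique with (qpoch (a * a) (p * p)); [|now apply qpoch_lim].
  apply Clim_ext with (fun n => qpoch a p n * qpoch (- a) p n).
  - intros n. apply qpoch_opp.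
  - apply Clim_mult; now apply qpoch_lim.
Qed.

(** Both sides are [(-1;p)_{n+1}], with its last or its first factor split off; the first factor is
    2. *)
Lemma qpoch_m1 (p : C) (n : nat) :
  qpoch (- (1)) p n * (1 + cpow p n) = 2 * qpoch (- p) p n.
Proof.
  pose proof (qpoch_head (- (1)) p n) as H. simpl in H.
  replace (- (1) * p) with (- p) in H by ring.
  replace (1 + cpow p n) with (1 - - (1) * cpow p n) by ring. rewrite H. ring.
Qed.

Lemma gauss_cpow_sq (q : C) (k : nat) : gauss (- q) (q * q) k = cpow q (k * k).
Proof.
  induction k as [|k IH]; simpl; [ring|].
  rewrite IH, cpow_mult_base.
  replace (k + k * S k)%nat with (k + k + k * k)%nat by lia.
  rewrite !cpow_add. ring.
Qed.

Lemma gauss_cpow_pronic (q : C) (k : nat) :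
  gauss (- (q * q)) (q * q) k = cpow q (k * k + k).
Proof.
  replace (- (q * q)) with (- q * q) by ring.
  rewrite cpow_add, <- gauss_cpow_sq.
  generalize (- q). intros w. induction k as [|k IH]; simpl; [ring|]. rewrite IH. ring.
Qed.

Lemma qpoch_small_neq_0 (a p : C) (n : nat) :
  (Cmod p < 1)%R -> (Cmod a < 1)%R -> qpoch a p n <> 0.
Proof. intros. now apply qpoch_neq_0, qpoch_regular_small. Qed.

Section Terms.

Variable q : C.
Hypothesis hq : (Cmod q < 1)%R.

(** [(-q;q)_{2k}] cancels between [(-1;q)_{2k}] and [(Q;Q)_{2k} = (q;q)_{2k} (-q;q)_{2k}], and
    [(q;q)_{2k} = (q;Q)_k (Q;Q)_k] supplies the denominator of [hterm], where [aw = q]. *)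
Lemma even_term (k : nat) :
  cpow q (k * k + 2 * k) * qpoch (- (1)) q (2 * k) * qpoch (- (1)) (q * q) k
  / qpoch (q * q) (q * q) (2 * k) = 2 * hlterm (- (1)) (- q) (q * q) k.
Proof.
  pose proof (Cmod_sq_lt_1 q hq) as hQ.
  pose proof (one_plus_cpow_sq_neq_0 q hq k) as H1.
  assert (E : qpoch (- (1)) q (2 * k) = 2 * qpoch (- q) q (2 * k) / (1 + cpow (q * q) k)).
  { rewrite <- qpoch_m1, cpow_double. field. exact H1. }
  rewrite E, <- (qpoch_opp q q), (qpoch_even q q).
  unfold hlterm, hterm.
  replace (- (1) * - q) with q by ring.
  replace (1 - - (1) * cpow (q * q) k) with (1 + cpow (q * q) k) by ring.
  rewrite gauss_cpow_sq, (cpow_add q (k * k)), cpow_double. field.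
  repeat split; trivial; apply qpoch_small_neq_0; rewrite ?Cmod_opp; trivial.
Qed.

(** The same reduction without the factor [Q^k], followed by [1 = (1 + Q^k) - Q^k]. *)
Lemma even_term_0 (k : nat) :
  cpow q (k * k) * qpoch (- (1)) q (2 * k) * qpoch (- (1)) (q * q) k
  / qpoch (q * q) (q * q) (2 * k)
  = 2 * hterm (- (1)) (- q) (q * q) k - 2 * hlterm (- (1)) (- q) (q * q) k.
Proof.
  pose proof (Cmod_sq_lt_1 q hq) as hQ.
  pose proof (one_plus_cpow_sq_neq_0 q hq k) as H1.
  assert (E : qpoch (- (1)) q (2 * k) = 2 * qpoch (- q) q (2 * k) / (1 + cpow (q * q) k)).
  { rewrite <- qpoch_m1, cpow_double. field. exact H1. }
  rewrite E, <- (qpoch_opp q q), (qpoch_even q q).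
  unfold hlterm, hterm.
  replace (- (1) * - q) with q by ring.
  replace (1 - - (1) * cpow (q * q) k) with (1 + cpow (q * q) k) by ring.
  rewrite gauss_cpow_sq. field.
  repeat split; trivial; apply qpoch_small_neq_0; rewrite ?Cmod_opp; trivial.
Qed.

(** Here [(-1;q)_{2k+1} = 2 (-q;q)_{2k}] cancels all of [(-q;q)_{2k+1}] but the factor [1 + q Q^k].
    In [(q;q)_{2k+1}] the factor [1 - q] is taken out so that [(qQ;Q)_k] appears, as [aw = qQ]
    demands. *)
Lemma odd_quotient (k : nat) :
  qpoch (- (1)) q (2 * k + 1) / qpoch (q * q) (q * q) (2 * k + 1)
  = 2 / ((1 - q) * (1 + q * cpow (q * q) k)
         * (qpoch (q * (q * q)) (q * q) k * qpoch (q * q) (q * q) k)).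
Proof.
  pose proof (Cmod_sq_lt_1 q hq) as hQ.
  rewrite <- (qpoch_opp q q), Nat.add_1_r, qpoch_head.
  replace (- (1) * q) with (- q) by ring. rewrite !qpoch_succ.
  rewrite (qpoch_even q q), cpow_double.
  rewrite (qpoch_shift q (q * q)) by now apply one_minus_neq_0.
  replace (1 - - q * cpow (q * q) k) with (1 + q * cpow (q * q) k) by ring.
  field.
  pose proof (Cmod_shift_lt_1 q (q * q) k hQ hq).
  repeat split; try (apply qpoch_small_neq_0; rewrite ?Cmod_opp; trivial);
    now (apply one_minus_neq_0 || apply one_plus_neq_0).
Qed.

Lemma odd_term (k : nat) :
  cpow q (k * k + 3 * k + 1) * qpoch (- (1)) q (2 * k + 1) * qpoch (- q) (q * q) k
  / qpoch (q * q) (q * q) (2 * k + 1)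
  = 2 * q / (1 - q) * hlterm (- q) (- (q * q)) (q * q) k.
Proof.
  pose proof (Cmod_sq_lt_1 q hq) as hQ.
  pose proof (Cmod_shift_lt_1 q (q * q) k hQ hq).
  transitivity (cpow q (k * k + 3 * k + 1) * qpoch (- q) (q * q) k
    * (qpoch (- (1)) q (2 * k + 1) / qpoch (q * q) (q * q) (2 * k + 1))).
  { unfold Cdiv. ring. }
  rewrite odd_quotient. unfold hlterm, hterm.
  replace (- q * - (q * q)) with (q * (q * q)) by ring.
  replace (1 - - q * cpow (q * q) k) with (1 + q * cpow (q * q) k) by ring.
  rewrite gauss_cpow_pronic.
  replace (k * k + 3 * k + 1)%nat with (k * k + k + 2 * k + 1)%nat by lia.
  rewrite (cpow_add q _ 1), (cpow_add q _ (2 * k)), cpow_double.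
  simpl (cpow q 1). field.
  repeat split; try (now (apply one_minus_neq_0 || apply one_plus_neq_0));
    apply qpoch_small_neq_0; trivial.
  rewrite Cmod_mult. pose proof (Cmod_ge_0 q). pose proof (Cmod_ge_0 (q * q)). nra.
Qed.

(** Now the splitting is [1 = (1 + q Q^k) - q Q^k]. *)
Lemma odd_term_0 (k : nat) :
  cpow q (k * k + k) * qpoch (- (1)) q (2 * k + 1) * qpoch (- q) (q * q) k
  / qpoch (q * q) (q * q) (2 * k + 1)
  = 2 / (1 - q) * hterm (- q) (- (q * q)) (q * q) k
    - 2 * q / (1 - q) * hlterm (- q) (- (q * q)) (q * q) k.
Proof.
  pose proof (Cmod_sq_lt_1 q hq) as hQ.
  pose proof (Cmod_shift_lt_1 q (q * q) k hQ hq).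
  transitivity (cpow q (k * k + k) * qpoch (- q) (q * q) k
    * (qpoch (- (1)) q (2 * k + 1) / qpoch (q * q) (q * q) (2 * k + 1))).
  { unfold Cdiv. ring. }
  rewrite odd_quotient. unfold hlterm, hterm.
  replace (- q * - (q * q)) with (q * (q * q)) by ring.
  replace (1 - - q * cpow (q * q) k) with (1 + q * cpow (q * q) k) by ring.
  rewrite gauss_cpow_pronic. field.
  repeat split; try (now (apply one_minus_neq_0 || apply one_plus_neq_0));
    apply qpoch_small_neq_0; trivial.
  rewrite Cmod_mult. pose proof (Cmod_ge_0 q). pose proof (Cmod_ge_0 (q * q)). nra.
Qed.

End Terms.

Theorem theorem1p4 (q : C) (hq : (Cmod q < 1)%R) :
  let P1 := qpoch_inf q q in
  let P2 := qpoch_inf (q*q) (q*q) in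
  let P4 := qpoch_inf (cpow q 4) (cpow q 4) in
  let q2 := q * q in
  is_series (V := C_NormedModule)
    (fun k => cpow q (k*k) * qpoch (-1) q (2*k) * qpoch (-1) q2 k
              / qpoch q2 q2 (2*k))
    (/2 * (3 * (cpow P2 3 / (cpow P1 2 * P4)) - cpow P1 2 * P2 / P4)) /\
  is_series (V := C_NormedModule)
    (fun k => cpow q (k*k + 2*k) * qpoch (-1) q (2*k) * qpoch (-1) q2 k
              / qpoch q2 q2 (2*k))
    (/2 * (cpow P2 3 / (cpow P1 2 * P4) + cpow P1 2 * P2 / P4)) /\
  is_series (V := C_NormedModule)
    (fun k => cpow q (k*k + k) * qpoch (-1) q (2*k+1) * qpoch (-q) q2 k
              / qpoch q2 q2 (2*k+1))
    (/2 * (3 * (P4 / P1) + cpow P1 3 * P4 / cpow P2 2)) /\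
  is_series (V := C_NormedModule)
    (fun k => cpow q (k*k + 3*k + 1) * qpoch (-1) q (2*k+1) * qpoch (-q) q2 k
              / qpoch q2 q2 (2*k+1))
    (/2 * (P4 / P1 - cpow P1 3 * P4 / cpow P2 2)).
Proof.
  intros P1 P2 P4 q2. fold q2 in P2.
  pose proof (Cmod_sq_lt_1 q hq) as hQ. fold q2 in hQ.
  assert (hQ' : (Cmod (- q2) < 1)%R) by now rewrite Cmod_opp.
  assert (hq' : (Cmod (- q) < 1)%R) by now rewrite Cmod_opp.
  assert (hqQ : (Cmod (q * q2) < 1)%R).
  { rewrite Cmod_mult. pose proof (Cmod_ge_0 q). pose proof (Cmod_ge_0 q2). nra. }
  (* All products reduce to [a1], [b1], [b2] and [P2] through [P1 = a1 P2], [P4 = P2 b2] and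
     [a1 b1 b2 = 1]. *)
  set (a1 := qpoch_inf q q2). set (b1 := qpoch_inf (- q) q2). set (b2 := qpoch_inf (- q2) q2).
  assert (E1 : P1 = a1 * P2) by (symmetry; now apply qpoch_inf_even).
  assert (E4 : P4 = P2 * b2).
  { unfold P4. replace (cpow q 4) with (q2 * q2) by (unfold q2; simpl; ring).
    symmetry. now apply qpoch_inf_opp. }
  assert (E2 : a1 * b1 * P4 = P2).
  { unfold a1, b1. rewrite qpoch_inf_opp by trivial.
    unfold P4. replace (cpow q 4) with (q2 * q2) by (unfold q2; simpl; ring).
    now apply qpoch_inf_even. }
  assert (nz : forall a, (Cmod a < 1)%R -> qpoch_inf a q2 <> 0)
    by (intros; now apply qpoch_inf_neq_0, qpoch_regular_small).
  pose proof (nz q hq : a1 <> 0) as Ha1. pose proof (nz _ hq' : b1 <> 0) as Hb1.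
  pose proof (nz _ hQ' : b2 <> 0) as Hb2. pose proof (nz _ hQ : P2 <> 0) as HP2.
  pose proof (one_minus_neq_0 q hq) as H1q.
  pose proof (regular_m1 q hq) as Hm1. fold q2 in Hm1.
  pose proof (qpoch_regular_small _ _ hQ hq') as Hregq.
  assert (Haw1 : qpoch_regular (- (1) * - q) q2).
  { replace (- (1) * - q) with q by ring. now apply qpoch_regular_small. }
  assert (Haw2 : qpoch_regular (- q * - q2) q2).
  { replace (- q * - q2) with (q * q2) by ring. now apply qpoch_regular_small. }
  destruct (lambert_ex (- (1)) (- q) q2 hQ hq' Hm1) as [g Hg].
  destruct (lambert_ex (- q) (- q2) q2 hQ hQ' Hregq) as [h Hh].
  (* [lambert_sym] needs both parameters inside the unit disc, so it is applied at [(-Q, -q)];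
     [lambert_shift_a] then links [G(-Q,-q)] to [G(-1,-q)]. *)
  destruct (lambert_ex (- q2) (- q) q2 hQ hq' (qpoch_regular_small _ _ hQ hQ')) as [h' Hh'].
  pose proof (lambert_sym _ _ _ _ _ hQ hQ' hq' Hh' Hh) as Eh. subst h'.
  replace (- q2) with (- (1) * q2) in Hh' by ring.
  pose proof (lambert_shift_a _ _ _ _ _ Hm1 Hg Hh') as Egh.
  pose proof (lambert_two_squares q hq g Hg) as Esq. cbv zeta in Esq.
  fold q2 in Esq. fold a1 b1 b2 P2 in Esq.
  pose proof (hterm_sum (- (1)) (- q) q2 hQ hq' Haw1) as S12.
  pose proof (hlterm_sum (- (1)) (- q) q2 g hQ hq' Hm1 Haw1 Hg) as S2.
  pose proof (hterm_sum (- q) (- q2) q2 hQ hQ' Haw2) as S34.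
  pose proof (hlterm_sum (- q) (- q2) q2 h hQ hQ' Hregq Haw2 Hh) as S4.
  replace (- (1) * - q) with q in S12, S2 by ring.
  replace (- q * - q2) with (q * q2) in S34, S4 by ring.
  fold a1 b1 in S12, S2. fold b2 in S34, S4.
  assert (Ea : qpoch_inf (q * q2) q2 = a1 / (1 - q)).
  { unfold a1. rewrite (qpoch_inf_head q q2) by trivial. field. exact H1q. }
  rewrite Ea in S34, S4.
  (* Euler: (q;q^2)(-q;q^2)(-q^2;q^2) = 1 *)
  assert (Eb2 : b2 = / (a1 * b1)).
  { rewrite E4 in E2.
    replace b2 with (a1 * b1 * (P2 * b2) / (a1 * b1 * P2)) by (field; auto).
    rewrite E2. field. auto. }
  (* The two-square theorem solved for [g]: with [1 / (b1 b2) = a1], the quotient [(v/u)^2] becomes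
     [a1^4 P2^2 = P1^4 / P2^2]. *)
  assert (Eg : g = (1 + P1 * P1 * (P1 * P1) / (P2 * P2)) / 4).
  { rewrite E1.
    replace g with ((b1 / P2 * (b1 / P2) * (4 * g - 1) * (P2 * P2 / (b1 * b1)) + 1) / 4)
      by (field; auto).
    rewrite Esq, Eb2. field. auto. }
  assert (Eqh : q * h = / 2 - g) by (rewrite Egh; field).
  replace (RtoC (-1)) with (- (1)) by ring.
  split; [|split; [|split]]; apply Cseries_is_series.
  - apply Cseries_ext with (fun k => 2 * hterm (- (1)) (- q) q2 k
                                     - 2 * hlterm (- (1)) (- q) q2 k).
    { intros k. symmetry. now apply even_term_0. }
    replace (/ 2 * _) with (2 * (b1 / a1) - 2 * (b1 / a1 * g)).
    { apply Cseries_minus; now apply Cseries_scal. }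
    rewrite Eg, E4, E1, Eb2. simpl. field. auto.
  - apply Cseries_ext with (fun k => 2 * hlterm (- (1)) (- q) q2 k).
    { intros k. symmetry. now apply even_term. }
    replace (/ 2 * _) with (2 * (b1 / a1 * g)).
    { now apply Cseries_scal. }
    rewrite Eg, E4, E1, Eb2. simpl. field. auto.
  - apply Cseries_ext with (fun k => 2 / (1 - q) * hterm (- q) (- q2) q2 k
                                     - 2 * q / (1 - q) * hlterm (- q) (- q2) q2 k).
    { intros k. symmetry. now apply odd_term_0. }
    replace (/ 2 * _) with (2 / (1 - q) * (b2 / (a1 / (1 - q)))
                            - 2 * q / (1 - q) * (b2 / (a1 / (1 - q)) * h)).
    { apply Cseries_minus; now apply Cseries_scal. }
    (* The prefactor [1 / (1 - q)] cancels against [(qQ;Q)_inf = a1 / (1 - q)], and [h] survives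
       only in the product [q * h], so [q = 0] needs no separate case. *)
    transitivity (2 * b2 / a1 * (1 - q * h)); [field; auto|].
    rewrite Eqh, Eg, E4, E1. simpl. field. auto.
  - apply Cseries_ext with (fun k => 2 * q / (1 - q) * hlterm (- q) (- q2) q2 k).
    { intros k. symmetry. now apply odd_term. }
    replace (/ 2 * _) with (2 * q / (1 - q) * (b2 / (a1 / (1 - q)) * h)).
    { now apply Cseries_scal. }
    transitivity (2 * b2 / a1 * (q * h)); [field; auto|].
    rewrite Eqh, Eg, E4, E1. simpl. field. auto.
Qed.
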